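(* Let $N\ge 1$, let $k_\omega>0$ and $k_v>0$ be arbitrary constants, and suppose that Assumptions 1, 2 and 3 (stated in the context) hold. Let $H=[h_{ij}]\in\mathbb{R}^{N\times N}$ be given by $h_{ij}=-a_{ij}$ for $i\ne j$ and $h_{ii}=\sum_{j=0}^N a_{ij}$. Then the origin $(\bar\theta,\bar x,\bar y)=0$ of the time-varying system on $\mathbb{R}^{3N}$ $$\dot{\bar\theta}=-k_\omega H\bar\theta,$$ $$\dot{\bar x}=-k_vH\bar x+\omega_0(t)\bar y-k_\omega\tilde y_0(t)H\bar\theta-k_\omega\,\mathrm{diag}(\bar y)H\bar\theta,$$ $$\dot{\bar y}=-\omega_0(t)\bar x+k_\omega\tilde x_0(t)H\bar\theta+k_\omega\,\mathrm{diag}(\bar x)H\bar\theta$$ is uniformly globally asymptotically stable. Consequently, the distributed control law $$\omega_i=-k_\omega\sum_{j=0}^Na_{ij}(\theta_i-\theta_j)+\omega_0,\qquad v_i=-k_v\sum_{j=0}^Na_{ij}(\tilde x_i-\tilde x_j)+v_0,\qquad i=1,\dots,N,$$ solves the leader-following cooperative tracking problem: for every initial time $t_0\ge0$ and all initial values $x_i(t_0),y_i(t_0),\theta_i(t_0)$, $i=1,\dots,N$, the trajectories of the follower robots under this control law exist for all $t\ge t_0$, and for every $i=1,\dots,N$, $$\lim_{t\to\infty}\big([x_i(t),y_i(t),\theta_i(t)]-[x_0(t),y_0(t),\theta_0(t)]\big)=0.$$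
   Context: Follower robots $i=1,\dots,N$: $\dot x_i=v_i\cos\theta_i$, $\dot y_i=v_i\sin\theta_i$, $\dot\theta_i=\omega_i$, with states $x_i,y_i,\theta_i\in\mathbb{R}$ and control inputs $v_i,\omega_i\in\mathbb{R}$. Leader (index $0$): $\dot x_0=v_0(t)\cos\theta_0$, $\dot y_0=v_0(t)\sin\theta_0$, $\dot\theta_0=\omega_0(t)$, where $v_0(t),\omega_0(t)$ are given time-varying functions available to all robots, and $(x_0,y_0,\theta_0)$ is a given solution defined for $t\ge0$. Communication network: a directed graph $\bar{\mathcal G}=(\bar{\mathcal V},\bar{\mathcal E})$ with $\bar{\mathcal V}=\{0,1,\dots,N\}$; an edge $(j,i)\in\bar{\mathcal E}$ means robot $i$ can receive information from robot $j$. The weights $a_{ij}\ge0$ ($i=1,\dots,N$, $j=0,\dots,N$) satisfy $a_{ii}=0$ and, for $i\neq j$, $a_{ij}>0$ if and only if $(j,i)\in\bar{\mathcal E}$. Transformed coordinates, for $i=0,1,\dots,N$: $\tilde x_i=x_i\cos\theta_i+y_i\sin\theta_i$ and $\tilde y_i=-x_i\sin\theta_i+y_i\cos\theta_i$. Errors, for $i=1,\dots,N$: $\bar\theta_i=\theta_i-\theta_0$, $\bar x_i=\tilde x_i-\tilde x_0$, $\bar y_i=\tilde y_i-\tilde y_0$; $\bar\theta,\bar x,\bar y\in\mathbb{R}^N$ are the stacked vectors. The system in the claim is the closed-loop error system obtained from the control law. For $\xi\in\mathbb{R}^N$, $\mathrm{diag}(\xi)$ is the diagonal matrix with diagonal entries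 $\xi_1,\dots,\xi_N$. Assumption 1: there is $M>0$ with $|x_0(t)|\le M$ and $|y_0(t)|\le M$ for all $t\ge0$. Assumption 2: $\omega_0$ is differentiable and there is $\bar\omega>0$ with $|\omega_0(t)|\le\bar\omega$ and $|\dot\omega_0(t)|\le\bar\omega$ for all $t\ge0$; moreover there are $T>0$ and $\mu>0$ with $\int_t^{t+T}\omega_0^2(\tau)\,d\tau\ge\mu$ for all $t\ge0$. Assumption 3: $\bar{\mathcal G}$ contains a directed spanning tree with node $0$ as its root. Uniform global asymptotic stability of the origin means: there is a class $\mathcal{KL}$ function $\beta$ such that every solution $z$ with initial time $t_0\ge0$ satisfies $\|z(t)\|\le\beta(\|z(t_0)\|,t-t_0)$ for all $t\ge t_0$. *)

(* Defs.v *)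
From mathcomp Require Import all_boot all_order all_algebra.
From mathcomp Require Import all_classical all_reals all_analysis.
Import Order.TTheory GRing.Theory Num.Theory.
Import numFieldNormedType.Exports.

Set Implicit Arguments.
Unset Strict Implicit.
Unset Printing Implicit Defensive.

Local Open Scope classical_set_scope.
Local Open Scope ring_scope.

(* The derivative is relative to [D]: two-sided at the interior points of an
   interval [D], one-sided at an endpoint belonging to [D]. *)
Definition derivative_in (R : realType) (D : set R) (g : R -> R) (t d : R) : Prop :=
  (g s - g t) / (s - t) @[s --> within D t^'] --> d.

Definition solution_on (R : realType) (n : nat) (f : R -> 'cV[R]_n -> 'cV[R]_n)
    (D : set R) (z : R -> 'cV[R]_n) : Prop :=
  forall t, D t ->
  forall i, derivative_in D (fun s => z s i 0) t (f t (z t) i 0).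

(* The trajectories exist for all t >= t0: every initial value problem posed at
   a time t0 >= 0 has a solution on [t0, +oo[, and no solution stops at a finite
   time t1, since each solution on [t0, t1[ continues to one on [t0, +oo[. *)
Definition forward_complete (R : realType) (n : nat)
    (f : R -> 'cV[R]_n -> 'cV[R]_n) : Prop :=
  (forall (t0 : R) (z0 : 'cV[R]_n), 0 <= t0 ->
     exists2 z, z t0 = z0 & solution_on f `[t0, +oo[ z) /\
  (forall (t0 t1 : R) (z : R -> 'cV[R]_n), 0 <= t0 -> t0 < t1 ->
     solution_on f `[t0, t1[ z ->
     exists2 w, solution_on f `[t0, +oo[ w &
       forall t, t0 <= t < t1 -> w t = z t).

(* The library norm on matrices is the sup norm. *)
Definition enorm (R : realType) (n : nat) (z : 'cV[R]_n) : R :=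
  Num.sqrt (\sum_(i < n) z i 0 ^+ 2).

Definition class_KL (R : realType) (beta : R -> R -> R) : Prop :=
  [/\ {within [set p : R * R | 0 <= p.1 /\ 0 <= p.2],
         continuous (fun p : R * R => beta p.1 p.2)},
      (forall s : R, 0 <= s -> beta 0 s = 0),
      (forall s r1 r2 : R, 0 <= s -> 0 <= r1 -> r1 < r2 -> beta r1 s < beta r2 s),
      (forall r s1 s2 : R, 0 <= r -> 0 <= s1 -> s1 <= s2 -> beta r s2 <= beta r s1) &
      (forall r : R, 0 <= r -> beta r s @[s --> +oo] --> 0)].

(* Forward completeness makes the bound below apply to every solution, at all
   times t >= t0. *)
Definition UGAS (R : realType) (n : nat) (f : R -> 'cV[R]_n -> 'cV[R]_n) : Prop :=
  forward_complete f /\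
  exists2 beta : R -> R -> R, class_KL beta &
    forall (t0 : R) (z : R -> 'cV[R]_n), 0 <= t0 ->
    solution_on f `[t0, +oo[ z ->
    forall t, t0 <= t -> enorm (z t) <= beta (enorm (z t0)) (t - t0).

(* For [e : rel V], [e j i] is the edge (j, i), along which j sends to i. *)
Definition directed_tree (V : finType) (r : V) (e : rel V) : Prop :=
  [/\ forall j, ~~ e j r,
      forall i, i != r -> #|[set j | e j i]%SET| = 1%N &
      forall i, connect e r i].

Definition contains_spanning_tree (V : finType) (r : V) (e : rel V) : Prop :=
  exists2 T : rel V, subrel T e & directed_tree r T.

(* Robots are indexed by 'I_N.+1: the leader is [ord0], and the follower of
   index [i : 'I_N] is [lift ord0 i]. *)
Definition weights_of (R : realType) (N : nat) (e : rel 'I_N.+1)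
    (a : 'M[R]_(N, N.+1)) : Prop :=
  [/\ forall i j, 0 <= a i j,
      forall i, a i (lift ord0 i) = 0 &
      forall i j, j != lift ord0 i -> (0 < a i j <-> e j (lift ord0 i))].

Definition Hmx (R : realType) (N : nat) (a : 'M[R]_(N, N.+1)) : 'M[R]_N :=
  \matrix_(i, j) if i == j then \sum_k a i k else - a i (lift ord0 j).

(* The values of a quantity at all the robots, from its value [s0] at the
   leader and its values [s] at the followers. *)
Definition with_leader (R : realType) (N : nat) (s0 : R) (s : 'cV[R]_N)
    (j : 'I_N.+1) : R :=
  if unlift ord0 j is Some k then s k 0 else s0.

Definition xtilde (R : realType) (x y theta : R) : R :=
  x * cos theta + y * sin theta.

Definition ytilde (R : realType) (x y theta : R) : R :=
  - x * sin theta + y * cos theta.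

Definition leader_motion (R : realType) (v0 w0 x0 y0 theta0 : R -> R) : Prop :=
  forall t : R, 0 <= t ->
  [/\ derivative_in `[0, +oo[ x0 t (v0 t * cos (theta0 t)),
      derivative_in `[0, +oo[ y0 t (v0 t * sin (theta0 t)) &
      derivative_in `[0, +oo[ theta0 t (w0 t)].

Definition leader_bounded (R : realType) (x0 y0 : R -> R) : Prop :=
  exists2 M : R, 0 < M & forall t : R, 0 <= t -> `|x0 t| <= M /\ `|y0 t| <= M.

Definition bounded_exciting (R : realType) (w0 : R -> R) : Prop :=
  (exists2 wbar : R, 0 < wbar &
     forall t : R, 0 <= t -> `|w0 t| <= wbar /\
       exists2 d : R, derivative_in `[0, +oo[ w0 t d & `|d| <= wbar) /\
  (exists T mu : R, [/\ 0 < T, 0 < mu &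
     forall t : R, 0 <= t ->
       mu <= \int[lebesgue_measure]_(tau in `[t, t + T]) (w0 tau ^+ 2)]).

(* The state is the stacked vector (thetabar, xbar, ybar). *)
Definition error_system (R : realType) (N : nat) (a : 'M[R]_(N, N.+1))
    (kw kv : R) (w0 x0 y0 theta0 : R -> R) (t : R)
    (z : 'cV[R]_(N + (N + N))) : 'cV[R]_(N + (N + N)) :=
  let H := Hmx a in
  let thetabar := usubmx z in
  let xbar := usubmx (dsubmx z) in
  let ybar := dsubmx (dsubmx z) in
  let xt0 := xtilde (x0 t) (y0 t) (theta0 t) in
  let yt0 := ytilde (x0 t) (y0 t) (theta0 t) in
  col_mx (- kw *: (H *m thetabar))
    (col_mx
      (- kv *: (H *m xbar) + w0 t *: ybar - (kw * yt0) *: (H *m thetabar)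
         - kw *: (diag_mx ybar^T *m H *m thetabar))
      (- w0 t *: xbar + (kw * xt0) *: (H *m thetabar)
         + kw *: (diag_mx xbar^T *m H *m thetabar))).

Definition omega_control (R : realType) (N : nat) (a : 'M[R]_(N, N.+1))
    (kw w0 theta0 : R) (theta : 'cV[R]_N) (i : 'I_N) : R :=
  let th := with_leader theta0 theta in
  - kw * (\sum_(j < N.+1) a i j * (th (lift ord0 i) - th j)) + w0.

Definition v_control (R : realType) (N : nat) (a : 'M[R]_(N, N.+1))
    (kv v0 x0 y0 theta0 : R) (x y theta : 'cV[R]_N) (i : 'I_N) : R :=
  let xt j := xtilde (with_leader x0 x j) (with_leader y0 y j)
                     (with_leader theta0 theta j) in
  - kv * (\sum_(j < N.+1) a i j * (xt (lift ord0 i) - xt j)) + v0.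

Definition follower_x (R : realType) (N : nat) (z : 'cV[R]_(N + (N + N))) :
  'cV[R]_N := usubmx z.
Definition follower_y (R : realType) (N : nat) (z : 'cV[R]_(N + (N + N))) :
  'cV[R]_N := usubmx (dsubmx z).
Definition follower_theta (R : realType) (N : nat) (z : 'cV[R]_(N + (N + N))) :
  'cV[R]_N := dsubmx (dsubmx z).

(* The state is the stacked vector (x, y, theta) of the followers. *)
Definition follower_system (R : realType) (N : nat) (a : 'M[R]_(N, N.+1))
    (kw kv : R) (v0 w0 x0 y0 theta0 : R -> R) (t : R)
    (z : 'cV[R]_(N + (N + N))) : 'cV[R]_(N + (N + N)) :=
  let x := follower_x z in
  let y := follower_y z in
  let theta := follower_theta z in
  let w := omega_control a kw (w0 t) (theta0 t) theta in
  let v := v_control a kv (v0 t) (x0 t) (y0 t) (theta0 t) x y theta in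
  col_mx (\col_i (v i * cos (theta i 0)))
    (col_mx (\col_i (v i * sin (theta i 0))) (\col_i w i)).

(* Since the existence clause of [forward_complete] ranges over all initial
   values, this covers every initial configuration of the followers. *)
Definition solves_tracking (R : realType) (N : nat) (a : 'M[R]_(N, N.+1))
    (kw kv : R) (v0 w0 x0 y0 theta0 : R -> R) : Prop :=
  let F := follower_system a kw kv v0 w0 x0 y0 theta0 in
  forward_complete F /\
  forall (t0 : R) (z : R -> 'cV[R]_(N + (N + N))), 0 <= t0 ->
    solution_on F `[t0, +oo[ z ->
    forall i : 'I_N,
    [/\ follower_x (z t) i 0 - x0 t @[t --> +oo] --> 0,
        follower_y (z t) i 0 - y0 t @[t --> +oo] --> 0 &
        follower_theta (z t) i 0 - theta0 t @[t --> +oo] --> 0].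

(* Main.v *)
(* In the coordinates (theta, x, y) of the error system the follower i rotates
   at the speed omega_i = w0 - kw (H theta)_i, so that the terms nonlinear in the
   state are skew and the cascade is linear in (x, y) once theta is known.

   H is a nonsingular M-matrix: if q solves q H = (1, ..., 1), then q > 0 and
   2 u^T diag(q) H u >= |u|^2. Hence theta decays exponentially and the weighted
   energy V of (x, y) satisfies V' <= - const |x|^2 up to terms driven by H theta.
   A strict Lyapunov function is
     U = (c - psi(t)) V - T w0(t) x^T diag(q) y,
   where T is the length of the window of persistent excitation and psi is a
   bounded function with psi' >= mu - T w0^2: the derivative of the cross term
   produces - T w0^2 |y|^2, which psi trades for - mu |y|^2, and c absorbs all the
   terms in |x|^2. With a multiple of the energy of theta added, this gives
     |z(t)| <= C |z(t0)| exp(c |z(t0)| - lambda (t - t0)).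

   The input v0 is not assumed to be continuous or even measurable. This is
   harmless: v0 = xt0' - w0 yt0 for the transformed coordinates (xt0, yt0) of the
   leader, and the error system does not contain v0, so the
   followers' motion is recovered from a solution of the error system, which is
   itself given by two linear equations with continuous bounded coefficients. *)
Require Import Defs.
From mathcomp Require Import all_boot all_order all_algebra.
From mathcomp Require Import all_classical all_reals all_analysis.
From mathcomp Require Import ring lra.
Import Order.TTheory GRing.Theory Num.Theory.
Import numFieldNormedType.Exports.
Local Open Scope classical_set_scope.
Local Open Scope ring_scope.

Set Implicit Arguments.
Unset Strict Implicit.
Unset Printing Implicit Defensive.

(** * Derivatives relative to a set *)

Section DerivativeIn.
Context {R : realType}.
Implicit Types (D E : set R) (f g : R -> R) (t d : R).

Lemma near_eq_cvg_to (T : Type) (F : set_system T) {FF : Filter F}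
    (f g : T -> R) (l : R) :
  (\forall s \near F, g s = f s) -> f s @[s --> F] --> l -> g s @[s --> F] --> l.
Proof. by move=> fg fl; apply: (cvg_trans _ fl); apply: near_eq_cvg; apply: filterS fg => s ->. Qed.

Lemma derivative_in_cvg D f t d :
  derivative_in D f t d -> f s @[s --> within D t^'] --> f t.
Proof.
move=> fd.
have idt : (s - t) @[s --> within D t^'] --> (0 : R).
  rewrite -[X in _ --> X](subrr t); apply: cvgB; last exact: cvg_cst.
  exact: cvg_trans (@cvg_within _ _ _ D) (@nbhs_dnbhs _ t).
have H : (f s - f t) / (s - t) * (s - t) + f t @[s --> within D t^'] --> d * 0 + f t.
  by apply: cvgD; [exact: cvgM|exact: cvg_cst].
rewrite mulr0 add0r in H; apply: (near_eq_cvg_to _ H); near=> s.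
by have [->|st] := eqVneq s t; rewrite ?subrr ?mulr0 ?add0r// divfK ?subr_eq0// subrK.
Unshelve. all: by end_near. Qed.

Lemma derivative_in_eq D f t d d' :
  d = d' -> derivative_in D f t d -> derivative_in D f t d'.
Proof. by move=> ->. Qed.

Lemma derivative_in_cst D (c : R) t : derivative_in D (fun=> c) t 0.
Proof.
rewrite /derivative_in (_ : (fun s => _) = cst 0); first exact: cvg_cst.
by apply/funext => s; rewrite subrr mul0r.
Qed.

Lemma derivative_inD D f g t d e :
  derivative_in D f t d -> derivative_in D g t e ->
  derivative_in D (fun s => f s + g s) t (d + e).
Proof.
move=> fd ge; rewrite /derivative_in.
rewrite (_ : (fun s => _) =
  (fun s => (f s - f t) / (s - t) + (g s - g t) / (s - t))); first exact: cvgD.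
by apply/funext => s; rewrite -mulrDl; congr (_ / _); ring.
Qed.

Lemma derivative_inM D f g t d e :
  derivative_in D f t d -> derivative_in D g t e ->
  derivative_in D (fun s => f s * g s) t (d * g t + f t * e).
Proof.
move=> fd ge; rewrite /derivative_in.
rewrite (_ : (fun s => _) =
  (fun s => (f s - f t) / (s - t) * g t + f s * ((g s - g t) / (s - t)))).
  apply: cvgD; first by apply: cvgM => //; exact: cvg_cst.
  by apply: cvgM => //; exact: derivative_in_cvg fd.
by apply/funext => s; ring.
Qed.

Lemma derivative_inZ D c f t d :
  derivative_in D f t d -> derivative_in D (fun s => c * f s) t (c * d).
Proof.
move=> fd; apply: derivative_in_eq (derivative_inM (derivative_in_cst D c t) fd).
by rewrite mul0r add0r.
Qed.

Lemma derivative_inN D f t d :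
  derivative_in D f t d -> derivative_in D (fun s => - f s) t (- d).
Proof.
move=> /(@derivative_inZ D (-1) f t d); rewrite mulN1r.
by rewrite (_ : (fun s => -1 * f s) = (fun s => - f s))//; apply/funext => s; rewrite mulN1r.
Qed.

Lemma derivative_inB D f g t d e :
  derivative_in D f t d -> derivative_in D g t e ->
  derivative_in D (fun s => f s - g s) t (d - e).
Proof. by move=> fd /derivative_inN; exact: derivative_inD. Qed.

Lemma derivative_in_sum D (I : finType) (f : I -> R -> R) t (d : I -> R) :
  (forall i, derivative_in D (f i) t (d i)) ->
  derivative_in D (fun s => \sum_i f i s) t (\sum_i d i).
Proof.
move=> fd; elim: (index_enum I) => [|i r IH].
  rewrite big_nil (_ : (fun s => _) = cst 0); first exact: derivative_in_cst.
  by apply/funext => s; rewrite big_nil.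
rewrite big_cons (_ : (fun s => _) = (fun s => f i s + \sum_(j <- r) f j s)).
  exact: derivative_inD.
by apply/funext => s; rewrite big_cons.
Qed.

(** Caratheodory's factorisation [phi r - phi (f t) = q r * (r - f t)] with [q] continuous at [f t]
    avoids dividing by [f s - f t], which may vanish for [s] close to [t]. *)
Lemma derivative_in_comp D (phi : R -> R) f t d e :
  derivative_in D f t d -> is_derive (f t) 1 phi e ->
  derivative_in D (fun s => phi (f s)) t (e * d).
Proof.
move=> fd /is_derive1_caratheodory [q [phiE qC <-]]; rewrite /derivative_in.
rewrite (_ : (fun s => _) = (fun s => q (f s) * ((f s - f t) / (s - t)))).
  apply: cvgM => //.
  by apply: (cvg_comp f q) qC; exact: derivative_in_cvg fd.
by apply/funext => s; rewrite phiE mulrA.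
Qed.

Lemma derivative_in_subset D E f t d :
  E `<=` D -> derivative_in D f t d -> derivative_in E f t d.
Proof. by move=> /within_subset ED; apply: cvg_trans; apply: cvg_app; exact: ED. Qed.

Lemma derivative_in_ext D f g t d :
  {in D, f =1 g} -> D t -> derivative_in D f t d -> derivative_in D g t d.
Proof.
move=> fg Dt; rewrite /derivative_in => fd.
apply: (near_eq_cvg_to _ fd); near=> s.
have Ds : D s by near: s; exact: withinT.
by rewrite !fg ?inE.
Unshelve. all: by end_near. Qed.

Lemma is_derive_derivative_in D f t d :
  is_derive t 1 f d -> derivative_in D f t d.
Proof.
move=> /is_derive1_caratheodory [q [fE qC <-]]; rewrite /derivative_in.
have : q s @[s --> within D t^'] --> q t.
  apply: cvg_trans qC; apply: cvg_app.
  exact: cvg_trans (@cvg_within _ _ _ D) (@nbhs_dnbhs _ t).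
move=> H; apply: (near_eq_cvg_to _ H); near=> s.
rewrite fE mulfK// subr_eq0; near: s.
by rewrite near_withinE; near=> s => _; near: s; exact: nbhs_dnbhs_neq.
Unshelve. all: by end_near. Qed.

(** The slope of [f] at [t], completed by the value [d] at [t] itself, is a continuous Caratheodory
    factor, since the restriction to [D] is void near [t]. *)
Lemma derivative_in_is_derive D f t d :
  nbhs t D -> derivative_in D f t d -> is_derive t 1 f d.
Proof.
move=> Dt fd; apply/is_derive1_caratheodory.
exists (fun s => if s == t then d else (f s - f t) / (s - t)); split.
- move=> s; case: eqVneq => [->|st]; first by rewrite !subrr mulr0.
  by rewrite divfK// subr_eq0.
- apply/continuous_withinNx; rewrite eqxx.
  have : (f s - f t) / (s - t) @[s --> t^'] --> d.
    move: fd; rewrite /derivative_in; apply: cvg_trans; apply: cvg_app.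
    move=> A /= ; rewrite /within/= => tA.
    near=> s; have : D s -> A s by near: s; exact: tA.
    by apply; near: s; exact: nbhs_dnbhs Dt.
  move=> H; apply: (near_eq_cvg_to _ H); near=> s.
  by rewrite ifF//; apply/negbTE; near: s; exact: nbhs_dnbhs_neq.
- by rewrite eqxx.
Unshelve. all: by end_near. Qed.

Lemma derivative_in_continuous D f (d : R -> R) :
  (forall t, D t -> derivative_in D f t (d t)) -> {within D, continuous f}.
Proof.
move=> fd; apply/subspace_continuousP => t Dt.
have := derivative_in_cvg (fd t Dt).
move=> ft A fA; have := ft A fA.
rewrite /= /nbhs/= /within/= => H; rewrite /within/=.
have := nbhs_singleton fA => At.
move: H; rewrite /dnbhs /within/= => H.
near=> s => Ds; have [->//|st] := eqVneq s t.
by move: (st) (Ds); near: s.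
Unshelve. all: by end_near. Qed.

Lemma derivative_in_id D t : derivative_in D (fun s => s) t 1.
Proof. by apply: is_derive_derivative_in; exact: is_derive_id. Qed.

Lemma derivative_in_affine D (K t0 t : R) :
  derivative_in D (fun s => K * (s - t0)) t K.
Proof.
have := derivative_inZ (c := K)
  (derivative_inB (derivative_in_id D t) (derivative_in_cst D t0 t)).
by rewrite subr0 mulr1.
Qed.

Lemma derivative_in_expR_affine D (K t0 t : R) :
  derivative_in D (fun s => expR (K * (s - t0))) t (K * expR (K * (t - t0))).
Proof.
rewrite mulrC; apply: (@derivative_in_comp D expR (fun s => K * (s - t0))).
exact: derivative_in_affine.
Qed.

(** The mean value theorem on [[a, b]]: relative derivatives become two-sided in the open interval
    and still give continuity at the endpoints. *)
Lemma nonincreasing_derivative_in D f (d : R -> R) (a b : R) :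
  a <= b -> `[a, b] `<=` D ->
  (forall t, a <= t <= b -> derivative_in D f t (d t) /\ d t <= 0) ->
  f b <= f a.
Proof.
move=> ab abD fd.
have fd' t : `[a, b]%classic t -> derivative_in `[a, b] f t (d t).
  rewrite /= in_itv/= => /fd[+ _]; exact: derivative_in_subset.
have [|c cab fE] := @MVT_segment R f d a b ab _ (derivative_in_continuous fd').
  move=> t; rewrite in_itv/= => /andP[at_ tb].
  apply: (@derivative_in_is_derive `[a, b]).
    have tab : t \in `]a, b[%R by rewrite in_itv/= at_ tb.
    by apply: filterS (near_in_itvoo tab) => s; exact: subset_itv_oo_cc.
  by apply: fd'; rewrite /= in_itv/= !ltW.
rewrite -subr_le0 fE mulr_le0_ge0 ?subr_ge0//.
by move: cab; rewrite in_itv/= => /fd[].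
Qed.

(** Both [f - g] and [- f - g] have a nonpositive derivative. *)
Lemma le_increment_derivative_in D f g (d e : R -> R) (a b : R) :
  a <= b -> `[a, b] `<=` D ->
  (forall t, a <= t <= b -> [/\ derivative_in D f t (d t),
     derivative_in D g t (e t) & `|d t| <= e t]) ->
  `|f b - f a| <= g b - g a.
Proof.
move=> ab abD fg; rewrite ler_norml; apply/andP; split.
  suff : - f b - g b <= - f a - g a by lra.
  apply: (@nonincreasing_derivative_in D (fun s => - f s - g s) (fun s => - d s - e s)) => //.
  move=> t /fg[fd ge]; rewrite ler_norml => /andP[de1 de2]; split.
    by apply: derivative_inB => //; exact: derivative_inN.
  by lra.
suff : f b - g b <= f a - g a by lra.
apply: (@nonincreasing_derivative_in D (fun s => f s - g s) (fun s => d s - e s)) => //.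
move=> t /fg[fd ge]; rewrite ler_norml => /andP[de1 de2]; split.
  exact: derivative_inB.
by lra.
Qed.

(** With [M] a primitive of the rate [m], the product [f * expR (- M)] is nonincreasing; no sign of
    [f] or [m] enters. *)
Lemma gronwall D f (d M m : R -> R) (a b : R) :
  a <= b -> `[a, b] `<=` D ->
  (forall t, a <= t <= b -> [/\ derivative_in D f t (d t),
     derivative_in D M t (m t) & d t <= m t * f t]) ->
  f b <= f a * expR (M b - M a).
Proof.
move=> ab abD fd.
suff : f b * expR (- M b) <= f a * expR (- M a).
  by rewrite -ler_pdivlMr ?expR_gt0// -expRN opprK -mulrA -expRD addrC.
apply: (@nonincreasing_derivative_in D (fun s => f s * expR (- M s))
  (fun s => d s * expR (- M s) + f s * (expR (- M s) * - m s))) => //.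
move=> t /fd[fdt Mdt dm]; split.
  apply: derivative_inM => //.
  by apply: (derivative_in_comp (derivative_inN Mdt)); exact: is_derive_expR.
rewrite (_ : _ + _ = (d t - m t * f t) * expR (- M t)); last by ring.
by rewrite mulr_le0_ge0 ?expR_ge0// subr_le0.
Qed.

(** Integrating from [t0 - 1] puts every [t >= t0] in the interior, so that the fundamental theorem
    applies at [t0] too. Composing with [Num.max x t0] makes the primitive constant to the left of
    [t0], hence continuous on the whole line. *)
Lemma continuous_primitive f (t0 : R) : continuous f ->
  exists F : R -> R, [/\ F t0 = 0, continuous F &
    forall t, t0 <= t -> derivative_in `[t0, +oo[ F t (f t)].
Proof.
move=> fC.
pose G x := (\int[lebesgue_measure]_(t in `[t0 - 1, x]) f t)%R.
have G' t : t0 <= t -> is_derive t 1 G (f t).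
  move=> t0t; have tu : t < t + 1 by lra.
  have fi : lebesgue_measure.-integrable `[t0 - 1, t + 1] (EFin \o f).
    apply: continuous_compact_integrable; first exact: segment_compact.
    exact: continuous_subspaceT.
  have [|Gd Gt] := @continuous_FTC1_closed R f (t0 - 1) t (t + 1) tu fi _ (fC t).
    by lra.
  by rewrite -Gt derive1E; apply/derivableP.
exists (fun x => G (Num.max x t0) - G t0); split; first by rewrite maxxx subrr.
- move=> x; apply: cvgB; last exact: cvg_cst.
  apply: (cvg_comp (fun x => Num.max x t0) G).
    by apply: (@continuous_max _ _ id (cst t0)); [exact: cvg_id|exact: cvg_cst].
  have /G' Gx : t0 <= Num.max x t0 by rewrite le_max lexx orbT.
  by apply/differentiable_continuous/derivable1_diffP; exact: ex_derive.
- move=> t t0t; rewrite -[f t]subr0.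
  apply: derivative_inB; last exact: derivative_in_cst.
  apply: derivative_in_ext (is_derive_derivative_in _ (G' _ t0t)).
    by move=> s; rewrite inE/= in_itv/= andbT => /max_idPl ->.
  by rewrite /= in_itv/= t0t.
Qed.

End DerivativeIn.

(** * Linear differential equations *)

Section LinearODE.
Context {R : realType}.

Lemma le_half_expn (c e : R) : 0 < e -> exists n : nat, c / 2 ^+ n <= e.
Proof.
move=> e0; exists (Num.bound (c / e)).
rewrite ler_pdivrMr ?exprn_gt0// mulrC -ler_pdivrMr//.
have [ce0|ce0] := leP (c / e) 0; first by rewrite (le_trans ce0)// exprn_ge0.
apply: (le_trans (ltW (archi_boundP (ltW ce0)))).
by rewrite -natrX ler_nat ltnW// ltn_expl.
Qed.

(** The intervals of centre [u n] and radius [2 * c / 2 ^+ n] are nested; the supremum of their left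
    ends lies in all of them. *)
Lemma half_geometric_limit (u : nat -> R) (c : R) :
  (forall n, `|u n.+1 - u n| <= c / 2 ^+ n) ->
  exists l, forall n, `|l - u n| <= 2 * c / 2 ^+ n.
Proof.
move=> uc; pose v n := u n - 2 * c / 2 ^+ n; pose w n := u n + 2 * c / 2 ^+ n.
have half n : 2 * c / 2 ^+ n.+1 = c / 2 ^+ n.
  by rewrite exprS; field; rewrite expf_neq0.
have c0 n : 0 <= c / 2 ^+ n by exact: le_trans (uc n).
have vS n : v n <= v n.+1.
  rewrite /v half; have := uc n; rewrite ler_norml => /andP[? ?].
  by have := c0 n; rewrite -mulrA; lra.
have wS n : w n.+1 <= w n.
  rewrite /w half; have := uc n; rewrite ler_norml => /andP[? ?].
  by have := c0 n; rewrite -mulrA; lra.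
have vw n m : v n <= w m.
  have vm k : v n <= v (n + k)%N.
    by elim: k => [|k IH]; rewrite ?addn0// addnS (le_trans IH).
  have wm k : w (m + k)%N <= w m.
    by elim: k => [|k IH]; rewrite ?addn0// addnS (le_trans _ IH).
  apply: (le_trans (vm m)); apply: le_trans (wm n); rewrite addnC /v /w.
  by have := c0 (m + n)%N; rewrite -mulrA; lra.
have vsup : has_sup (range v).
  by split; [exists (v 0%N), 0%N|exists (w 0%N) => _ [n _ <-]].
exists (sup (range v)) => n; rewrite ler_norml.
have : v n <= sup (range v) by apply: ub_le_sup; [case: vsup|exists n].
have : sup (range v) <= w n by apply: ge_sup; [case: vsup|move=> _ [m _ <-]].
by rewrite /v /w => ? ?; apply/andP; split; lra.
Qed.

(** Integration gains a factor [1 / K] in the norm weighted by [expR (K * (t - t0))]; this drives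
    the contraction in the Picard iteration below. *)
Lemma exp_growth_bound (K c t0 : R) (u u' : R -> R) :
  0 <= c -> u t0 = 0 ->
  (forall t, t0 <= t -> derivative_in `[t0, +oo[ u t (u' t)) ->
  (forall t, t0 <= t -> `|u' t| <= c * (K * expR (K * (t - t0)))) ->
  forall t, t0 <= t -> `|u t| <= c * expR (K * (t - t0)).
Proof.
move=> c0 ut0 du u'K t t0t.
have := @le_increment_derivative_in R `[t0, +oo[ u
  (fun s => c * expR (K * (s - t0))) u'
  (fun s => c * (K * expR (K * (s - t0)))) t0 t t0t.
rewrite ut0 subr0 => H; apply: (le_trans (H _ _)).
- by apply: subset_itvl.
- move=> s /andP[t0s _]; split; [exact: du| |exact: u'K].
  by apply: derivative_inZ; exact: derivative_in_expR_affine.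
- by rewrite gerBl mulr_ge0// expR_ge0.
Qed.

Lemma continuous_sum (I : finType) (f : I -> R -> R) :
  (forall i, continuous (f i)) -> continuous (fun t => \sum_i f i t).
Proof. by move=> fC t; apply: cvg_big => [|i _]; [exact: add_continuous|exact: fC]. Qed.

(** Picard iteration. Bounded coefficients make the integral operator a contraction of ratio 1/2 in
    an exponentially weighted norm on the whole half-line, so the solution is global at once. *)
Lemma linear_ode_exists (I : finType) (A : R -> I -> I -> R) (b : R -> I -> R)
    (L B t0 : R) (z0 : I -> R) :
  0 <= L -> 0 <= B ->
  (forall i j, continuous (fun t => A t i j)) ->
  (forall i, continuous (fun t => b t i)) ->
  (forall t i j, `|A t i j| <= L) -> (forall t i, `|b t i| <= B) ->
  exists z : I -> R -> R, (forall i, z i t0 = z0 i) /\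
    forall i t, t0 <= t ->
      derivative_in `[t0, +oo[ (z i) t (\sum_j A t i j * z j t + b t i).
Proof.
move=> L0 B0 AC bC AL bB.
(* [J] chooses a primitive vanishing at [t0] for each continuous function; for a discontinuous [f]
   the default value is [f] itself. *)
have /choice[J JP] : forall f : R -> R, exists F : R -> R, continuous f ->
    [/\ F t0 = 0, continuous F &
      forall t, t0 <= t -> derivative_in `[t0, +oo[ F t (f t)].
  move=> f; have [fC|nfC] := pselect (continuous f); last by exists f.
  by have [F FP] := @continuous_primitive R f t0 fC; exists F.
pose field (u : I -> R -> R) i t := \sum_j A t i j * u j t + b t i.
pose step (u : I -> R -> R) i t := z0 i + J (field u i) (Num.max t t0).
pose S n := iter n step (fun i _ => z0 i).
have fieldC u : (forall i, continuous (u i)) -> forall i, continuous (field u i).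
  move=> uC i t; apply: cvgD; last exact: bC.
  by apply: continuous_sum => j {}t; apply: cvgM; [exact: AC|exact: uC].
have maxC : continuous (fun t => Num.max t t0).
  by move=> t; apply: (@continuous_max _ _ id (cst t0)); [exact: cvg_id|exact: cvg_cst].
have stepC u : (forall i, continuous (u i)) -> forall i, continuous (step u i).
  move=> uC i t; apply: cvgD; first exact: cvg_cst.
  have [_ JC _] := JP _ (fieldC _ uC i).
  by apply: (cvg_comp (fun x => Num.max x t0) (J (field u i))); [exact: maxC|exact: JC].
have SC n : forall i, continuous (S n i).
  by elim: n => [|n IH]; [move=> i t; exact: cvg_cst|exact: stepC].
have step0 u i : (forall i, continuous (u i)) -> step u i t0 = z0 i.
  by move=> uC; rewrite /step maxxx; have [-> _ _] := JP _ (fieldC _ uC i); rewrite addr0.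
have stepD u i t : (forall i, continuous (u i)) -> t0 <= t ->
    derivative_in `[t0, +oo[ (step u i) t (field u i t).
  move=> uC t0t; have [_ _ /(_ t t0t) JD] := JP _ (fieldC _ uC i).
  have := derivative_inD (derivative_in_cst `[t0, +oo[ (z0 i) t) JD.
  rewrite add0r; apply: derivative_in_ext; last by rewrite /= in_itv/= t0t.
  by move=> s; rewrite inE/= in_itv/= andbT /step => /max_idPl ->.
have step_max u i t : step u i t = step u i (Num.max t t0).
  by rewrite /step -maxA maxxx.
have S_max n i t : S n i t = S n i (Num.max t t0).
  by case: n => [//|n]; exact: step_max.
(* [K >= 2 * #|I| * L] gives the contraction ratio 1/2, and the added 1 gives [K >= 1] for the first
   iterate. [C] bounds the field along the constant iterate [S 0], and [E] is the weight, frozen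
   before [t0]. *)
pose K := 2 * #|I|%:R * L + 1.
pose C := L * (\sum_i `|z0 i|) + B.
pose E t := expR (K * (Num.max t t0 - t0)).
have K1 : 1 <= K by rewrite /K lerDr !mulr_ge0.
have C0 : 0 <= C by rewrite addr_ge0// mulr_ge0// sumr_ge0.
have fieldB (u v : I -> R -> R) (c : R) i t :
    (forall j, `|u j t - v j t| <= c * expR (K * (t - t0))) -> 0 <= c ->
    `|field u i t - field v i t| <= c / 2 * (K * expR (K * (t - t0))).
  move=> uv c0; rewrite /field opprD addrACA subrr addr0 -sumrB.
  apply: (le_trans (ler_norm_sum _ _ _)).
  apply: (@le_trans _ _ (\sum_(j : I) L * (c * expR (K * (t - t0))))).
    apply: ler_sum => j _; rewrite -mulrBr normrM.
    by apply: ler_pM.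
  rewrite sumr_const -[leLHS]mulr_natl.
  rewrite (_ : c / 2 * (K * _) = (#|I|%:R * (L * (c * expR (K * (t - t0))))) +
     c / 2 * expR (K * (t - t0))); last by rewrite /K; field.
  by rewrite lerDl !mulr_ge0// ?expR_ge0.
have SS n i t : t0 <= t ->
    `|S n.+1 i t - S n i t| <= C / 2 ^+ n * expR (K * (t - t0)).
  elim: n i t => [|n IH] i t t0t.
    rewrite expr0 divr1.
    apply: (@exp_growth_bound K C t0 (fun t => S 1%N i t - S 0%N i t)
      (fun t => field (S 0%N) i t)) => // [|s t0s|s t0s].
    - by rewrite /S/= step0 ?subrr// => j s; exact: cvg_cst.
    - rewrite -[field _ _ _]subr0; apply: derivative_inB.
        by apply: stepD => //; exact: (SC 0%N).
      exact: derivative_in_cst.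
    - apply: (@le_trans _ _ C).
        rewrite /field /C; apply: (le_trans (ler_normD _ _)); apply: lerD => //.
        apply: (le_trans (ler_norm_sum _ _ _)); rewrite mulr_sumr.
        by apply: ler_sum => j _; rewrite normrM ler_wpM2r.
      rewrite ler_peMr//; apply: mulr_ege1 => //.
      by rewrite -expR0 ler_expR mulr_ge0// ?subr_ge0// (le_trans ler01).
  apply: (@exp_growth_bound K (C / 2 ^+ n.+1) t0
    (fun t => S n.+2 i t - S n.+1 i t)
    (fun t => field (S n.+1) i t - field (S n) i t)) => // [||s t0s|s t0s].
  - by rewrite divr_ge0// exprn_ge0.
  - by rewrite /S/= !step0 ?subrr//; [exact: (SC n)|exact: (SC n.+1)].
  - by apply: derivative_inB; apply: stepD => //; first [exact: (SC n.+1)|exact: (SC n)].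
  - rewrite (_ : C / 2 ^+ n.+1 = C / 2 ^+ n / 2); last by rewrite exprSr invfM mulrA.
    apply: fieldB.
      by move=> j; exact: IH.
    by rewrite divr_ge0// exprn_ge0.
have EE t : t0 <= t -> E t = expR (K * (t - t0)) by rewrite /E => /max_idPl ->.
have /choice[z zP] : forall i, exists z : R -> R, forall t n,
    `|z t - S n i t| <= 2 * C / 2 ^+ n * E t.
  move=> i.
  have /choice[z zP] : forall t, exists l, forall n,
      `|l - S n i t| <= 2 * (C * E t) / 2 ^+ n.
    move=> t; apply: half_geometric_limit => n.
    rewrite [S n.+1 i t]S_max [S n i t]S_max mulrAC.
    by apply: SS; rewrite le_max lexx orbT.
  by exists z => t n; apply: le_trans (zP t n) _; rewrite !mulrA [_ * E t / _]mulrAC.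
have EC : continuous E.
  move=> t; apply: (cvg_comp (fun t => K * (Num.max t t0 - t0)) expR).
    by apply: cvgM; [exact: cvg_cst|apply: cvgB; [exact: maxC|exact: cvg_cst]].
  exact: continuous_expR.
(* Near [t] the weight [E] is at most [E t + 1], so the convergence is locally uniform there;
   continuity of the limit follows from three errors of size [e / 3]. *)
have zC i : continuous (z i).
  move=> t; apply/cvgrPdist_le => e e0.
  have e3 : 0 < e / 3 by lra.
  have [n nP] := @le_half_expn (2 * C * (E t + 1)) (e / 3) e3.
  near=> s.
  have Es : E s <= E t + 1.
    have : `|E t - E s| <= 1.
      by near: s; have /cvgrPdist_le := EC t; apply.
    by rewrite ler_norml => /andP[? ?]; lra.
  have St : `|S n i t - S n i s| <= e / 3.
    by near: s; have /cvgrPdist_le := SC n i t; apply; lra.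
  have bound r : E r <= E t + 1 -> `|z i r - S n i r| <= e / 3.
    move=> Er; apply: (le_trans (zP i r n)); apply: (le_trans _ nP).
    rewrite mulrAC ler_wpM2r// ?invr_ge0 ?exprn_ge0//.
    by apply: ler_wpM2l => //; rewrite mulr_ge0.
  have bt : `|z i t - S n i t| <= e / 3 by apply: bound; lra.
  have bs := bound _ Es.
  move: bt bs St; rewrite !ler_norml => /andP[? ?] /andP[? ?] /andP[? ?].
  by apply/andP; split; lra.
(* For every [n], both [step z] and [z] are within a multiple of [E t / 2 ^+ n] of the iterate
   [S n.+1]. Hence [z] is a fixed point of the integral operator, which yields its derivative. *)
have wz i t : t0 <= t -> step z i t = z i t.
  move=> t0t; apply/eqP; rewrite -subr_eq0 -normr_le0.
  apply/ler_addgt0Pr => e e0; rewrite add0r.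
  have [n nP] := @le_half_expn (4 * C * E t) e e0.
  have h1 : `|step z i t - S n.+1 i t| <= 2 * C / 2 ^+ n / 2 * expR (K * (t - t0)).
    apply: (@exp_growth_bound K (2 * C / 2 ^+ n / 2) t0
      (fun t => step z i t - S n.+1 i t)
      (fun t => field z i t - field (S n) i t)) => // [||s t0s|s t0s].
    - by rewrite !divr_ge0// ?exprn_ge0// mulr_ge0.
    - by rewrite /S/= !step0 ?subrr//; exact: (SC n).
    - by apply: derivative_inB; apply: stepD => //; exact: (SC n).
    - apply: fieldB; last by rewrite !divr_ge0// ?exprn_ge0// mulr_ge0.
      by move=> j; rewrite -EE//; exact: zP.
  have h2 := zP i t n.+1.
  rewrite -EE// in h1; apply: le_trans nP.
  rewrite (_ : step z i t - z i t =
    (step z i t - S n.+1 i t) - (z i t - S n.+1 i t)); last by ring.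
  apply: (le_trans (ler_normB _ _)); apply: (le_trans (lerD h1 h2)).
  rewrite (_ : _ + _ = 2 * C * E t / 2 ^+ n); last first.
    by rewrite exprS; field; rewrite expf_neq0.
  by rewrite ler_wpM2r ?invr_ge0 ?exprn_ge0// -!mulrA ler_wpM2r// ?mulr_ge0// ?expR_ge0//; lra.
exists z; split => [i|i t t0t].
  by rewrite -wz// step0.
apply: derivative_in_ext (stepD z i t zC t0t).
  by move=> s; rewrite inE/= in_itv/= andbT => /wz.
by rewrite /= in_itv/= t0t.
Unshelve. all: by end_near. Qed.

End LinearODE.

(** * The matrix H *)

Section GraphMatrix.
Context {R : realType} {N : nat}.
Variables (edge : rel 'I_N.+1) (a : 'M[R]_(N, N.+1)).
Hypothesis ha : weights_of edge a.

Lemma with_leader0 (s0 : R) (s : 'cV[R]_N) : with_leader s0 s ord0 = s0.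
Proof. by rewrite /with_leader unlift_none. Qed.

Lemma with_leader_lift (s0 : R) (s : 'cV[R]_N) i :
  with_leader s0 s (lift ord0 i) = s i 0.
Proof. by rewrite /with_leader liftK. Qed.

(** Write each difference of [s] as a difference of deviations from the leader's value: the leader's
    own deviation is 0, and the weight of robot [i] on itself is 0. This turns the sums in the
    control law into [H] acting on errors. *)
Lemma Hmx_consensus (s : 'I_N.+1 -> R) i :
  \sum_(j < N.+1) a i j * (s (lift ord0 i) - s j) =
  \sum_j Hmx a i j * (s (lift ord0 j) - s ord0).
Proof.
case: ha => _ aii _.
rewrite [RHS](bigD1 i)//= mxE eqxx mulr_suml.
rewrite [in RHS]big_ord_recl [LHS]big_ord_recl -addrA; congr (_ + _).
rewrite [LHS](bigD1 i)//= [X in _ = X + _](bigD1 i)//= subrr mulr0 aii mul0r !add0r.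
rewrite -big_split/=; apply: eq_bigr => j ji.
by rewrite mxE eq_sym (negbTE ji); ring.
Qed.

Lemma Hmx_offdiag_le0 i j : i != j -> Hmx a i j <= 0.
Proof. by case: ha => a0 _ _ ij; rewrite mxE (negbTE ij) oppr_le0. Qed.

(** Applying the consensus identity to the indicator of the followers shows that the row sum is the
    weight [a i ord0] on the leader. *)
Lemma Hmx_row_sum_ge0 i : 0 <= \sum_j Hmx a i j.
Proof.
have := Hmx_consensus (fun j => if j == ord0 then 0 else 1) i.
rewrite big_ord_recl/= [in X in _ + X]big1 ?addr0; last first.
  by move=> j _; rewrite subrr mulr0.
under [X in _ = X]eq_bigr do rewrite subr0 mulr1.
by move=> <-; case: ha => a0 _ _; rewrite subr0 mulr1.
Qed.

Hypothesis htree : contains_spanning_tree (ord0 : 'I_N.+1) edge.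

(* If the minimum m of u is negative, the set of robots where it is attained is
   stable under passing to an in-neighbour, hence contains the leader, at
   which the value is 0. *)
Lemma Hmx_minimum_principle (u : 'I_N -> R) :
  (forall i, 0 <= \sum_j Hmx a i j * u j) -> forall i, 0 <= u i.
Proof.
move=> Hu i0.
have [i _ mini] := @arg_minP _ R 'I_N i0 xpredT u isT.
have [//|ui_lt0] := leP 0 (u i); first by move=> /le_trans; apply; exact: mini.
pose w (j : 'I_N.+1) := if unlift ord0 j is Some k then u k else 0.
have w0 : w ord0 = 0 by rewrite /w unlift_none.
have wl k : w (lift ord0 k) = u k by rewrite /w liftK.
have wmin j : u i <= w j.
  by rewrite /w; case: unlift => [k|]; [exact: mini|exact: ltW].
(* The contrapositive form of stability: not being a minimiser is transmitted along edges, starting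
   from the leader. *)
have step (j k : 'I_N.+1) : edge j k -> w j != u i -> w k != u i.
  move=> ejk wj; case: (unliftP ord0 k) => [k' kE|->]; last first.
    by rewrite w0 gt_eqF.
  rewrite kE wl; apply/eqP => ukE.
  have jk : j != lift ord0 k' by apply: contraNneq wj => ->; rewrite wl ukE.
  case: ha => a0 aii aedge.
  have aj : 0 < a k' j by apply/aedge; rewrite // -kE.
  have := Hu k'.
  (* At a minimiser every term of this consensus sum is nonpositive and the one of index [j] is
     negative, against [Hu]. *)
  have -> : \sum_j0 Hmx a k' j0 * u j0 = \sum_j0 a k' j0 * (u i - w j0).
    rewrite -ukE -wl Hmx_consensus; apply: eq_bigr => l _.
    by rewrite w0 subr0 wl.
  apply/negP; rewrite -ltNge (bigD1 j)//=.
  have wj' : u i < w j by rewrite lt_neqAle eq_sym wj wmin.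
  have : a k' j * (u i - w j) < 0 by rewrite pmulr_rlt0// subr_lt0.
  have : \sum_(l < N.+1 | l != j) a k' l * (u i - w l) <= 0.
    by apply: sumr_le0 => l _; rewrite mulr_ge0_le0// subr_le0.
  by lra.
case: htree => T sTe [_ _ /(_ (lift ord0 i))/connectP[p pP pE]].
have: w (last ord0 p) != u i.
  have: w ord0 != u i by rewrite w0 gt_eqF.
  elim: p (ord0 : 'I_N.+1) pP {pE} => [//|k p IH] j /= /andP[jk kp] wj.
  by apply: IH => //; apply: step wj; exact: sTe.
by rewrite -pE wl eqxx.
Qed.

(** The minimum principle applied to a kernel vector and to its opposite shows that the vector is
    0. *)
Lemma Hmx_unit : Hmx a \in unitmx.
Proof.
rewrite -unitmx_tr -row_free_unit; apply: inj_row_free => v vH.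
have Hv j : \sum_k Hmx a j k * v 0 k = 0.
  have vHj : (v *m (Hmx a)^T) 0 j = 0 by rewrite vH mxE.
  rewrite mxE in vHj.
  by rewrite -[RHS]vHj; apply: eq_bigr => k _; rewrite [_^T _ _]mxE mulrC.
apply/rowP => j; rewrite mxE; apply/eqP; rewrite eq_le; apply/andP; split.
  rewrite -oppr_ge0; apply: (@Hmx_minimum_principle (fun k => - v 0 k)) => k.
  by under eq_bigr do rewrite mulrN; rewrite sumrN Hv oppr0.
by apply: (@Hmx_minimum_principle (fun k => v 0 k)) => k; rewrite Hv.
Qed.

(** Young's inequality on the nonpositive off-diagonal entries bounds the form below by a diagonal
    one, in which [u i ^+ 2 / 2] is multiplied by [q i] times the row sum of [H], which is
    nonnegative, plus the column sum of [diag(q) H], which is 1. *)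
Lemma exists_diagonal_lyapunov :
  exists2 q : 'I_N -> R, (forall i, 0 < q i) &
    forall u : 'I_N -> R,
      (\sum_i u i ^+ 2) / 2 <= \sum_i q i * (u i * \sum_j Hmx a i j * u j).
Proof.
pose q : 'rV[R]_N := const_mx 1 *m invmx (Hmx a).
have qH j : \sum_i q 0 i * Hmx a i j = 1.
  have : (q *m Hmx a) 0 j = 1 by rewrite mulmxKV ?Hmx_unit// mxE.
  by rewrite mxE.
(* [H] maps each column of its inverse to a basis vector, so the minimum principle makes all entries
   of the inverse nonnegative. *)
have q0 i : 0 <= q 0 i.
  rewrite mxE sumr_ge0// => j _; rewrite mxE mul1r.
  apply: (@Hmx_minimum_principle (fun k => invmx (Hmx a) k i)) => k.
  have : (Hmx a *m invmx (Hmx a)) k i = (k == i)%:R by rewrite mulmxV ?Hmx_unit// mxE.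
  rewrite mxE => ->.
  by rewrite ler0n.
exists (fun i => q 0 i) => [j|u].
  (* If [q j] vanished, only off-diagonal terms would remain in the column sum, making it
     nonpositive instead of 1. *)
  rewrite lt_neqAle q0 andbT eq_sym; apply/eqP => qj0.
  have := qH j; rewrite (bigD1 j)//= qj0 mul0r add0r => sum1.
  have : \sum_(i < N | i != j) q 0 i * Hmx a i j <= 0.
    by apply: sumr_le0 => i ij; rewrite mulr_ge0_le0// Hmx_offdiag_le0.
  by rewrite sum1 ler10.
have young i j : q 0 i * Hmx a i j * ((u i ^+ 2 + u j ^+ 2) / 2) <=
    q 0 i * (u i * (Hmx a i j * u j)).
  rewrite (_ : q 0 i * (u i * _) = q 0 i * Hmx a i j * (u i * u j)); last by ring.
  have [->|ij] := eqVneq i j; first by rewrite le_eqVlt; apply/orP; left; apply/eqP; field.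
  rewrite ler_wnM2l//; first by rewrite mulr_ge0_le0// Hmx_offdiag_le0.
  by have := sqr_ge0 (u i - u j); rewrite sqrrB; lra.
apply: (@le_trans _ _ (\sum_i \sum_j q 0 i * Hmx a i j * ((u i ^+ 2 + u j ^+ 2) / 2))); last first.
  by apply: ler_sum => i _; rewrite !mulr_sumr; apply: ler_sum => j _; exact: young.
have -> : \sum_i \sum_j q 0 i * Hmx a i j * ((u i ^+ 2 + u j ^+ 2) / 2) =
    \sum_i q 0 i * (u i ^+ 2 / 2) * (\sum_j Hmx a i j) +
    \sum_j (u j ^+ 2 / 2) * \sum_i q 0 i * Hmx a i j.
  under [X in _ = _ + X]eq_bigr do rewrite mulr_sumr.
  rewrite [X in _ = _ + X]exchange_big -big_split; apply: eq_bigr => i _ /=.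
  by rewrite mulr_sumr -big_split; apply: eq_bigr => j _ /=; ring.
under [X in _ <= _ + X]eq_bigr do rewrite qH mulr1.
rewrite -mulr_suml lerDr sumr_ge0// => i _.
apply: mulr_ge0; last exact: Hmx_row_sum_ge0.
by apply: mulr_ge0 => //; apply: divr_ge0 => //; exact: sqr_ge0.
Qed.

End GraphMatrix.

(** * Persistent excitation *)

Section Excitation.
Context {R : realType}.

(** Freezing [f] before [t0] extends it continuously to the whole line, the form in which
    [continuous_primitive] and [linear_ode_exists] take their data. *)
Lemma continuous_max_comp (f : R -> R) (d : R -> R) (t0 : R) :
  (forall t, t0 <= t -> derivative_in `[t0, +oo[ f t (d t)) ->
  continuous (fun t => f (Num.max t t0)).
Proof.
move=> df; have fC : {within `[t0, +oo[%classic, continuous f}.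
  apply: (@derivative_in_continuous _ _ _ d) => t.
  by rewrite /= in_itv/= andbT; exact: df.
move=> t; have t0m s : t0 <= Num.max s t0 by rewrite le_max lexx orbT.
have /subspace_continuousP/(_ (Num.max t t0)) := fC.
rewrite /= in_itv/= t0m => /(_ isT) fm; apply: (cvg_comp _ f _ fm) => A.
rewrite /= /nbhs/= /within/= => nA.
have maxC : Num.max s t0 @[s --> t] --> Num.max t t0.
  by apply: (@continuous_max _ _ id (cst t0)); [exact: cvg_id|exact: cvg_cst].
apply: (@filterS _ (nbhs t) _ (fun s => Num.max s t0 \in `[t0, +oo[%R -> A (Num.max s t0))).
  by move=> s /=; apply; rewrite in_itv/= t0m.
exact: (maxC _ nA).
Qed.

(* With S a primitive of w0^2, psi t is the integral over [t, t + T] of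
   S - S t; its derivative is the integral of w0^2 over [t, t + T] minus
   T * w0 t ^+ 2. *)
Lemma excitation_window (w0 : R -> R) : bounded_exciting w0 ->
  exists T mu psibar : R, exists psi dpsi : R -> R,
  [/\ 0 < T, 0 < mu & forall t, 0 <= t ->
    [/\ derivative_in `[0, +oo[ psi t (dpsi t), 0 <= psi t <= psibar &
        mu - T * w0 t ^+ 2 <= dpsi t]].
Proof.
move=> [[wb wb0 wP] [T [mu [T0 mu0 muP]]]].
have [dw dwP] : exists d : R -> R, forall t, 0 <= t ->
    derivative_in `[0, +oo[ w0 t (d t).
  have /choice[d dP] : forall t, exists d, 0 <= t -> derivative_in `[0, +oo[ w0 t d.
    move=> t; have [t0|] := leP 0 t; last by exists 0.
    by have [_ [d dP _]] := wP t t0; exists d.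
  by exists d.
have mC := continuous_max_comp dwP.
pose f t := w0 (Num.max t 0) ^+ 2.
have fC : continuous f by move=> t; apply: cvgM; exact: mC.
have fE t : 0 <= t -> f t = w0 t ^+ 2 by move=> /max_idPl; rewrite /f => ->.
have fb t : 0 <= t -> 0 <= f t <= wb ^+ 2.
  move=> t0; rewrite fE// sqr_ge0/= -real_normK ?num_real//.
  by rewrite ler_sqr ?nnegrE ?normr_ge0 ?(ltW wb0)//; have [] := wP t t0.
have [S [S0 SC SD]] := @continuous_primitive R f 0 fC.
have [Q [Q0 QC QD]] := @continuous_primitive R S 0 SC.
have S_incr s t : 0 <= s -> s <= t -> 0 <= S t - S s <= (t - s) * wb ^+ 2.
  move=> s0 st; apply/andP; split.
    rewrite subr_ge0 -lerN2.
    apply: (@nonincreasing_derivative_in R `[0, +oo[ (fun t => - S t) (fun t => - f t)) => //.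
      by apply: subset_itv => //.
    move=> u /andP[su _]; split; first by apply/derivative_inN/SD; exact: le_trans su.
    by rewrite oppr_le0; have /andP[] := fb u (le_trans s0 su).
  have := @nonincreasing_derivative_in R `[0, +oo[ (fun t => S t - wb ^+ 2 * (t - 0))
    (fun t => f t - wb ^+ 2) s t st.
  move=> H; suff : S t - wb ^+ 2 * (t - 0) <= S s - wb ^+ 2 * (s - 0) by lra.
  apply: H; first by apply: subset_itv.
  move=> u /andP[su _]; split.
    apply: derivative_inB; last exact: derivative_in_affine.
    by apply: SD; exact: le_trans su.
  by rewrite subr_le0; have /andP[] := fb u (le_trans s0 su).
(* The fundamental theorem turns the Lebesgue integral of the excitation hypothesis into an
   increment of [S]. *)
have Sint t : 0 <= t -> mu <= S (t + T) - S t.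
  move=> t0; apply: (le_trans (muP t t0)).
  have tT : t < t + T by lra.
  rewrite /Rintegral (_ : (\int[_]_(x in _) _)%E = (S (t + T))%:E - (S t)%:E)%E.
    by rewrite -EFinB.
  rewrite -(@continuous_FTC2 R f S t (t + T) tT).
  - apply: eq_integral => x; rewrite inE/= in_itv/= => /andP[tx _].
    by rewrite fE// (le_trans t0).
  - exact: continuous_subspaceT.
  - split.
    + move=> x; rewrite in_itv/= => /andP[tx _].
      apply: (@ex_derive _ _ _ _ _ _ (f x)).
      apply: (@derivative_in_is_derive _ `[0, +oo[); last by apply: SD; lra.
      by apply: filterS (lt_nbhsr (le_lt_trans t0 tx)) => y /ltW; rewrite /= in_itv/= andbT.
    + by apply: cvg_at_right_filter; exact: SC.
    + by apply: cvg_at_left_filter; exact: SC.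
  - move=> x; rewrite in_itv/= => /andP[tx _]; rewrite derive1E.
    apply: derive_val.
    apply: (@derivative_in_is_derive _ `[0, +oo[); last by apply: SD; lra.
    by apply: filterS (lt_nbhsr (le_lt_trans t0 tx)) => y /ltW; rewrite /= in_itv/= andbT.
(* On the window [S - S t] is at most [T * wb ^+ 2]; integrating it over the length [T] gives the
   bound of [psi]. *)
exists T, mu, (T ^+ 2 * wb ^+ 2).
exists (fun t => Q (t + T) - Q t - T * S t), (fun t => S (t + T) - S t - T * f t).
split=> // t t0; split.
- apply: derivative_inB; last by apply: derivative_inZ; exact: SD.
  apply: derivative_inB; last exact: QD.
  have /derivative_in_comp : derivative_in `[0, +oo[ (fun s => s + T) t 1.
    by have := derivative_inD (derivative_in_id `[0, +oo[ t)
      (derivative_in_cst `[0, +oo[ T t); rewrite addr0.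
  rewrite -[S (t + T)]mulr1; apply.
  apply: (@derivative_in_is_derive _ `[0, +oo[); last by apply: QD; lra.
  have tT : 0 < t + T by lra.
  by apply: filterS (lt_nbhsr tT) => y /ltW; rewrite /= in_itv/= andbT.
- have tT : t <= t + T by lra.
  have sub : `[t, t + T]%classic `<=` `[0, +oo[%classic.
    by move=> x; rewrite /= !in_itv/= andbT => /andP[tx _]; exact: le_trans tx.
  (* Subtracting an affine function of slope [K] compares the increment of [Q] with [K * T]. The
     slope [S t] gives [0 <= psi], and the slope [S t + T * wb ^+ 2] gives the upper bound. *)
  have D s K : 0 <= s -> derivative_in `[0, +oo[ (fun r => Q r - K * (r - 0)) s (S s - K).
    by move=> s0; apply: derivative_inB; [exact: QD|exact: derivative_in_affine].
  apply/andP; split.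
    suff : - (Q (t + T) - S t * (t + T - 0)) <= - (Q t - S t * (t - 0)) by lra.
    apply: (@nonincreasing_derivative_in R `[0, +oo[
      (fun r => - (Q r - S t * (r - 0))) (fun r => - (S r - S t))) => //.
    move=> s /andP[ts _]; split; first by apply/derivative_inN/D; exact: le_trans ts.
    by rewrite oppr_le0; have /andP[] := S_incr t s t0 ts.
  pose K := S t + T * wb ^+ 2.
  suff : Q (t + T) - K * (t + T - 0) <= Q t - K * (t - 0) by rewrite /K; lra.
  apply: (@nonincreasing_derivative_in R `[0, +oo[
    (fun r => Q r - K * (r - 0)) (fun r => S r - K)) => //.
  move=> s /andP[ts sT]; split; first by apply: D; exact: le_trans ts.
  have /andP[_ h] := S_incr t s t0 ts.
  have : (s - t) * wb ^+ 2 <= T * wb ^+ 2 by rewrite ler_wpM2r ?sqr_ge0//; lra.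
  by rewrite /K; lra.
- by rewrite fE// lerD2r; exact: Sint.
Qed.

End Excitation.

(** * Dissipation of the error system *)

Section WeightedForm.
Context {R : realType} {N : nat}.
Variable q : 'I_N -> R.
Hypothesis q_gt0 : forall i, 0 < q i.
Implicit Types u v : 'I_N -> R.

Definition wdot u v : R := \sum_i q i * (u i * v i).

Lemma wdot_ge0 u : 0 <= wdot u u.
Proof. by apply: sumr_ge0 => i _; rewrite pmulr_rge0// -expr2 sqr_ge0. Qed.

Lemma wdot_sqr_le u i : q i * u i ^+ 2 <= wdot u u.
Proof.
rewrite /wdot (bigD1 i)//= -expr2 lerDl; apply: sumr_ge0 => j _.
by rewrite pmulr_rge0// -expr2 sqr_ge0.
Qed.

(** Termwise, [e * (u i - c / (2 * e) * v i) ^+ 2] is nonnegative. The bound involves only [M], so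
    it is uniform for a time-varying coefficient [c]. *)
Lemma wdot_young u v (c M e : R) : 0 < e -> `|c| <= M ->
  c * wdot u v <= e * wdot u u + M ^+ 2 / (4 * e) * wdot v v.
Proof.
move=> e0 cM; rewrite /wdot !mulr_sumr -big_split/=; apply: ler_sum => i _.
have cM2 : c ^+ 2 <= M ^+ 2.
  rewrite -real_normK ?num_real// ler_sqr ?nnegrE//.
  exact: le_trans (normr_ge0 _) cM.
have h : c * (u i * v i) <= e * (u i * u i) + c ^+ 2 / (4 * e) * (v i * v i).
  have := mulr_ge0 (ltW e0) (sqr_ge0 (u i - c / (2 * e) * v i)).
  have -> : e * (u i - c / (2 * e) * v i) ^+ 2 =
      e * (u i * u i) + c ^+ 2 / (4 * e) * (v i * v i) - c * (u i * v i).
    by field; rewrite gt_eqF.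
  by rewrite subr_ge0.
rewrite mulrCA [X in _ <= X + _]mulrCA [X in _ <= _ + X]mulrCA -mulrDr.
apply: ler_wpM2l; first exact: ltW.
apply: (le_trans h); rewrite lerD2l.
rewrite ler_wpM2r -?expr2 ?sqr_ge0// ler_wpM2r// invr_ge0.
by rewrite mulr_ge0// ltW.
Qed.

Lemma derivative_in_wdot (D : set R) (u v : 'I_N -> R -> R) (du dv : 'I_N -> R) t :
  (forall i, derivative_in D (u i) t (du i)) ->
  (forall i, derivative_in D (v i) t (dv i)) ->
  derivative_in D (fun s => wdot (u^~ s) (v^~ s)) t
    (wdot du (v^~ t) + wdot (u^~ t) dv).
Proof.
move=> uD vD; rewrite /wdot -big_split/=.
under eq_bigr do rewrite -mulrDr.
apply: (derivative_in_sum (f := fun i s => q i * (u i s * v i s))) => i.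
by apply: derivative_inZ; exact: derivative_inM.
Qed.

(** Expand the squares and use [|u j * u k| <= u j ^+ 2 + u k ^+ 2], where each [u j ^+ 2] is at
    most the weighted form divided by [q j]. *)
Lemma wdot_matrix_bound (H : 'M[R]_N) : exists2 h : R, 0 <= h &
  forall u, wdot (fun i => \sum_j H i j * u j) (fun i => \sum_j H i j * u j) <=
    h * wdot u u.
Proof.
pose c (i j k : 'I_N) : R := q i * (`|H i j * H i k| * ((q j)^-1 + (q k)^-1)).
exists (\sum_i \sum_j \sum_k c i j k).
  do 3 (apply: sumr_ge0 => ? _).
  by rewrite pmulr_rge0// mulr_ge0// addr_ge0// invr_ge0 ltW.
move=> u; have V0 := wdot_ge0 u.
have uV j : u j ^+ 2 <= (q j)^-1 * wdot u u.
  by rewrite mulrC ler_pdivlMr// mulrC wdot_sqr_le.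
rewrite {1}/wdot mulr_suml; apply: ler_sum => i _.
rewrite big_distrlr/= mulr_sumr mulr_suml; apply: ler_sum => j _.
rewrite mulr_sumr mulr_suml; apply: ler_sum => k _.
rewrite /c -[leRHS]mulrA; apply: ler_wpM2l; first exact: ltW.
rewrite mulrACA -[leRHS]mulrA; apply: (le_trans (ler_norm _)); rewrite normrM.
apply: ler_wpM2l => //; rewrite mulrDl.
apply: (@le_trans _ _ (u j ^+ 2 + u k ^+ 2)); last exact: lerD.
rewrite ler_norml; apply/andP; split.
  by have := sqr_ge0 (u j + u k); rewrite sqrrD; have := sqr_ge0 (u j); have := sqr_ge0 (u k); lra.
by have := sqr_ge0 (u j - u k); rewrite sqrrB; have := sqr_ge0 (u j); have := sqr_ge0 (u k); lra.
Qed.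

End WeightedForm.

(** The left side is the derivative of [U = (c - psi) V - T w <x, y>], with numbers in place of the
    weighted products. For [g = H theta]: [X = <x, x>], [Y = <y, y>], [Gam = <g, g>], [p = <x, y>],
    [xh = <x, H x>], [hy = <y, H x>], [xg = <x, g>], [yg = <y, g>], [hh = <H x, H x>], and [e] is
    the cubic remainder of the cross term. *)
Lemma lyapunov_scalar_estimate (R : realType)
  (T mu wb m kw kv c1 h psib c psi Dpsi w dw xt yt G X Y Gam p xh hy xg yg e hh B : R) :
  0 < T -> 0 < mu -> 0 <= wb -> 0 <= m -> 0 < kw -> 0 < kv -> 0 < c1 -> 0 <= h ->
  0 <= psi <= psib -> mu - T * w ^+ 2 <= Dpsi -> `|w| <= wb -> `|dw| <= wb ->
  `|xt| <= m -> `|yt| <= m -> 0 <= X -> 0 <= Y -> 0 <= Gam ->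
  c1 * X <= xh -> hh <= h * X -> `|e| <= G * (X + Y) ->
  (forall d M eps, 0 < eps -> `|d| <= M ->
    [/\ d * p <= eps * Y + M ^+ 2 / (4 * eps) * X,
        d * hy <= eps * Y + M ^+ 2 / (4 * eps) * hh,
        d * xg <= eps * X + M ^+ 2 / (4 * eps) * Gam &
        d * yg <= eps * Y + M ^+ 2 / (4 * eps) * Gam]) ->
  psib <= c ->
  2 * T * wb ^+ 2 + 2 * (T * wb) ^+ 2 / mu + 2 * (T * wb * kv) ^+ 2 * h / mu
    <= (c - psib) * (2 * kv * c1) ->
  B = 2 * c * kw * m + T * wb * kw * m ->
  (c - psi) * (- (2 * kv) * xh + 2 * kw * (xt * yg - yt * xg))
  - Dpsi * (X + Y)
  - T * (dw * p + w * (- kv * hy + w * (Y - X) - kw * e - kw * yt * yg + kw * xt * xg))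
  <= - (mu / 2) * (X + Y) + T * wb * kw * G * (X + Y) + 4 * B ^+ 2 / mu * Gam.
Proof.
move=> T0 mu0 wb0 m0 kw0 kv0 c10 h0 /andP[psi0 psib1] Dp wb1 dwb xtm ytm X0 Y0 Gam0
  xhl hhh eG young psic cbig BE.
(* Young's inequality is used four times, each time spending [mu / 8] of [X] or [Y]; at least
   [mu / 2] of the decay [mu] survives. *)
have mu8 : 0 < mu / 8 by lra.
have T0' := ltW T0; have kw0' := ltW kw0; have kv0' := ltW kv0; have c10' := ltW c10.
have cpsi : 0 <= c - psi by lra.
have w2 : w ^+ 2 <= wb ^+ 2.
  by rewrite -real_normK ?num_real// ler_sqr ?nnegrE//.
(* The term [T * w ^+ 2 * Y] cancels against the cross term, whereas [T * w ^+ 2 * X] appears twice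
   and is bounded in [a2]. *)
have a1 : - Dpsi * (X + Y) <= - mu * (X + Y) + T * w ^+ 2 * (X + Y).
  by rewrite -mulrDl ler_wpM2r ?addr_ge0//; lra.
have a2 : 2 * (T * w ^+ 2 * X) <= 2 * T * wb ^+ 2 * X.
  rewrite mulrA ler_wpM2r// -mulrA ler_wpM2l// ler_wpM2l//.
have a3d : `|- (T * dw)| <= T * wb.
  by rewrite normrN normrM (gtr0_norm T0) ler_wpM2l.
have [a3 _ _ _] := young _ _ _ mu8 a3d.
have a4d : `|T * w * kv| <= T * wb * kv.
  by rewrite !normrM (gtr0_norm T0) (gtr0_norm kv0) ler_wpM2r// ler_wpM2l.
have [_ a4 _ _] := young _ _ _ mu8 a4d.
have a5 : T * w * kw * e <= T * wb * kw * G * (X + Y).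
  apply: (le_trans (ler_norm _)); rewrite !normrM (gtr0_norm T0) (gtr0_norm kw0).
  rewrite -[_ * G * _]mulrA; apply: ler_pM => //; first by rewrite !mulr_ge0//.
  by rewrite ler_wpM2r ?ler_wpM2l//.
(* The energy and the cross term both contribute to [yg] and [xg]; [B] bounds the joint coefficient,
   and the two uses below give [4 * B ^+ 2 / mu]. *)
have BB (s1 s2 : R) : `|s1| <= m -> `|s2| <= m ->
    `|(c - psi) * (2 * kw * s1) + T * w * kw * s2| <= B.
  move=> s1m s2m; apply: (le_trans (ler_normD _ _)); rewrite BE; apply: lerD.
    rewrite normrM (ger0_norm cpsi) normrM gtr0_norm; last by lra.
    rewrite (_ : 2 * c * kw * m = c * (2 * kw * m)); last by ring.
    apply: ler_pM => //; first by rewrite mulr_ge0//; lra.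
      by lra.
    by rewrite ler_wpM2l//; lra.
  rewrite !normrM (gtr0_norm T0) (gtr0_norm kw0).
  by apply: ler_pM => //; [rewrite !mulr_ge0|rewrite ler_wpM2r ?ler_wpM2l//].
have [_ _ _ a6] := young _ _ _ mu8 (BB xt yt xtm ytm).
have ytm' : `|- yt| <= m by rewrite normrN.
have xtm' : `|- xt| <= m by rewrite normrN.
have [_ _ a7 _] := young _ _ _ mu8 (BB (- yt) (- xt) ytm' xtm').
have a8 : (c - psib) * (2 * kv * c1) * X <= (c - psi) * (2 * kv) * xh.
  rewrite (_ : _ * X = (c - psib) * (2 * kv) * (c1 * X)); last by ring.
  apply: ler_pM => //; first by rewrite !mulr_ge0//; lra.
    by rewrite mulr_ge0// ltW.
  by rewrite ler_wpM2r//; lra.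
(* The dissipation of [x], amplified by [c - psib], absorbs all the remaining multiples of [X]. *)
have a9 := ler_wpM2r X0 cbig.
have a10 : (T * wb * kv) ^+ 2 / (4 * (mu / 8)) * hh <= 2 * (T * wb * kv) ^+ 2 * h / mu * X.
  rewrite (_ : _ * X = (T * wb * kv) ^+ 2 / (4 * (mu / 8)) * (h * X)).
    by rewrite ler_wpM2l// divr_ge0 ?sqr_ge0//; lra.
  by field; rewrite gt_eqF.
have e3 : (T * wb) ^+ 2 / (4 * (mu / 8)) = 2 * (T * wb) ^+ 2 / mu.
  by field; rewrite gt_eqF.
have e4 : B ^+ 2 / (4 * (mu / 8)) = 2 * B ^+ 2 / mu by field; rewrite gt_eqF.
rewrite e3 in a3; rewrite e4 in a6 a7.
move: a1 a2 a3 a4 a5 a6 a7 a8 a9 a10.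
have -> : 4 * B ^+ 2 / mu = 2 * (2 * B ^+ 2 / mu) by ring.
set b2 := 2 * B ^+ 2 / mu; set b3 := 2 * (T * wb) ^+ 2 / mu.
set b4 := (T * wb * kv) ^+ 2 / _; set b5 := 2 * _ * h / mu.
move=> a1 a2 a3 a4 a5 a6 a7 a8 a9 a10.
have mY : 0 <= mu * Y by rewrite mulr_ge0// ltW.
have mX : 0 <= mu * X by rewrite mulr_ge0// ltW.
lra.
Qed.

(** * The error system in coordinates and its quadratic forms *)

Definition Hact (R : realType) (N : nat) (a : 'M[R]_(N, N.+1)) (u : 'I_N -> R)
  (i : 'I_N) : R := \sum_j Hmx a i j * u j.

(* The error system in coordinates. Since omega_i = w0 - kw (H th)_i, the terms
   with diag(xbar) and diag(ybar) amount to a rotation at the speed omega_i. *)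
Definition error_motion (R : realType) (N : nat) (a : 'M[R]_(N, N.+1))
    (kw kv : R) (w0 xt0 yt0 : R -> R) (D : set R) (th x y : 'I_N -> R -> R) : Prop :=
  forall t, D t -> forall i,
  let g := Hact a (th^~ t) i in
  [/\ derivative_in D (th i) t (- kw * g),
      derivative_in D (x i) t (- kv * Hact a (x^~ t) i + (w0 t - kw * g) * y i t
        - kw * yt0 t * g) &
      derivative_in D (y i) t (- (w0 t - kw * g) * x i t + kw * xt0 t * g)].

Section ErrorMotion.
Context {R : realType} {N : nat}.
Variables (a : 'M[R]_(N, N.+1)) (kw kv : R) (w0 xt0 yt0 : R -> R).
Variable q : 'I_N -> R.

Local Notation motion := (error_motion a kw kv w0 xt0 yt0).
Local Notation "'<<' u , v '>>'" := (wdot q u v).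
Local Notation H := (Hact a).

Section Derivatives.
Variables (D : set R) (th x y : 'I_N -> R -> R).
Hypothesis hm : motion D th x y.
Variable t : R.
Hypothesis Dt : D t.

Let g := H (th^~ t).

Lemma error_motion_theta_form :
  derivative_in D (fun s => <<th^~ s, th^~ s>>) t (- (2 * kw) * <<th^~ t, g>>).
Proof.
have thD i : derivative_in D (th i) t (- kw * g i) by have [] := hm Dt i.
apply: derivative_in_eq (derivative_in_wdot thD thD).
by rewrite /wdot -big_split mulr_sumr; apply: eq_bigr => i _ /=; ring.
Qed.

Let dx i := - kv * H (x^~ t) i + (w0 t - kw * g i) * y i t - kw * yt0 t * g i.
Let dy i := - (w0 t - kw * g i) * x i t + kw * xt0 t * g i.
Let xD i : derivative_in D (x i) t (dx i). Proof. by have [] := hm Dt i. Qed.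
Let yD i : derivative_in D (y i) t (dy i). Proof. by have [] := hm Dt i. Qed.

(** The rotation at speed [w0 - kw * g i] contributes opposite amounts to the [x] and [y] parts, so
    only the damping and the terms driven by [g] remain. *)
Lemma error_motion_energy :
  derivative_in D (fun s => <<x^~ s, x^~ s>> + <<y^~ s, y^~ s>>) t
    (- (2 * kv) * <<x^~ t, H (x^~ t)>> +
     2 * kw * (xt0 t * <<y^~ t, g>> - yt0 t * <<x^~ t, g>>)).
Proof.
apply: derivative_in_eq
  (derivative_inD (derivative_in_wdot xD xD) (derivative_in_wdot yD yD)).
rewrite /wdot -!mulNr mulrDr !mulr_sumr -!big_split/=.
by apply: eq_bigr => i _ /=; rewrite /dx /dy; ring.
Qed.

(** Here the rotation does not cancel: its [w0] part is the source of decay for [y], and its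
    [kw * g i] part leaves a cubic remainder. *)
Lemma error_motion_cross :
  derivative_in D (fun s => <<x^~ s, y^~ s>>) t
    (- kv * <<y^~ t, H (x^~ t)>> + w0 t * (<<y^~ t, y^~ t>> - <<x^~ t, x^~ t>>)
     - kw * (\sum_i q i * (g i * (y i t ^+ 2 - x i t ^+ 2)))
     - kw * yt0 t * <<y^~ t, g>> + kw * xt0 t * <<x^~ t, g>>).
Proof.
apply: derivative_in_eq (derivative_in_wdot xD yD).
rewrite /wdot -!mulNr mulrBr -mulNr !mulr_sumr -!big_split/=.
by apply: eq_bigr => i _ /=; rewrite /dx /dy; ring.
Qed.

End Derivatives.
End ErrorMotion.

Definition sqnorm3 (R : realType) (N : nat) (th x y : 'I_N -> R) : R :=
  \sum_i (th i ^+ 2 + x i ^+ 2 + y i ^+ 2).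

(** * Coercivity, uniqueness of motions and decay of the angles *)

Section Decay.
Context {R : realType} {N : nat}.
Variables (edge : rel 'I_N.+1) (a : 'M[R]_(N, N.+1)).
Hypothesis ha : weights_of edge a.
Hypothesis htree : contains_spanning_tree (ord0 : 'I_N.+1) edge.
Variables (kw kv : R) (w0 xt0 yt0 : R -> R).
Hypotheses (hkw : 0 < kw) (hkv : 0 < kv).

Local Notation motion := (error_motion a kw kv w0 xt0 yt0).
Local Notation H := (Hact a).

(** Every [q i] is at most [Q], so the Euclidean bound of [exists_diagonal_lyapunov] becomes
    coercive for the weighted form with [c1 = 1 / (2 * Q)]; the summand 1 in [Q] ensures
    positivity. *)
Lemma exists_dissipation_form : exists q : 'I_N -> R, exists c1 h : R,
  [/\ forall i, 0 < q i, 0 < c1, 0 <= h &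
    forall u, c1 * wdot q u u <= wdot q u (H u) /\
      wdot q (H u) (H u) <= h * wdot q u u].
Proof.
have [q q0 qP] := exists_diagonal_lyapunov ha htree.
have [h h0 hP] := wdot_matrix_bound q0 (Hmx a).
have qs0 : 0 <= \sum_i q i by apply: sumr_ge0 => i _; exact: ltW.
pose Q := 1 + \sum_i q i.
have Q0 : 0 < Q by rewrite /Q; lra.
exists q, (2 * Q)^-1, h; split=> // [|u]; first by rewrite invr_gt0 mulr_gt0.
split; last exact: hP.
apply: le_trans (qP u).
rewrite /wdot mulr_sumr mulr_suml; apply: ler_sum => i _.
rewrite (_ : _ * _ = u i ^+ 2 / 2 * (q i / Q)); last by field; rewrite gt_eqF.
rewrite ler_piMr//; first by rewrite divr_ge0// sqr_ge0.
rewrite ler_pdivrMr// mul1r /Q (bigD1 i)//=.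
have : 0 <= \sum_(j < N | j != i) q j by apply: sumr_ge0 => j _; exact: ltW.
by have := q0 i; lra.
Qed.

(** The cascade is treated in order. The difference of the angles solves a dissipative linear
    equation; once the angles agree, so do the rotation speeds and the forcing, and the energy of
    the [(x, y)] difference cannot grow from 0. *)
Lemma error_motion_unique (D : set R) (t0 t : R) (th x y th' x' y' : 'I_N -> R -> R) :
  t0 <= t -> `[t0, t]%classic `<=` D ->
  motion D th x y -> motion D th' x' y' ->
  (forall i, [/\ th i t0 = th' i t0, x i t0 = x' i t0 & y i t0 = y' i t0]) ->
  forall i, [/\ th i t = th' i t, x i t = x' i t & y i t = y' i t].
Proof.
move=> t0t sub hm hm' h0.
have [q [c1 [h [q0 c10 _ qP]]]] := exists_dissipation_form.
have HB u v i : H (fun j => u j - v j) i = H u i - H v i.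
  by rewrite /Hact -sumrB; apply: eq_bigr => j _; rewrite mulrBr.
have Hge0 u : 0 <= wdot q u (H u).
  by apply: le_trans (qP u).1; rewrite mulr_ge0 ?wdot_ge0// ltW.
have zero u v : wdot q (fun i => u i - v i) (fun i => u i - v i) <= 0 ->
    forall i, u i = v i.
  move=> uv i; apply/eqP; rewrite -subr_eq0 -sqrf_eq0 eq_le sqr_ge0 andbT.
  have := wdot_sqr_le q0 (fun i => u i - v i) i => /= h1.
  by rewrite -(pmulr_rle0 _ (q0 i)); apply: le_trans uv.
have wdot00 u v : (forall i, u i = v i) ->
    wdot q (fun i => u i - v i) (fun i => u i - v i) = 0.
  by move=> uv; rewrite /wdot big1// => i _; rewrite uv subrr mulr0 mulr0.
have theq s : t0 <= s <= t -> forall i, th i s = th' i s.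
  move=> /andP[t0s st]; apply: zero.
  have <- : wdot q (fun i => th i t0 - th' i t0) (fun i => th i t0 - th' i t0) = 0.
    by apply: wdot00 => i; have [] := h0 i.
  have sub' : `[t0, s]%classic `<=` D.
    by apply: subset_trans sub; apply: subset_itvl.
  apply: (@nonincreasing_derivative_in R D
    (fun s => wdot q (fun i => th i s - th' i s) (fun i => th i s - th' i s))
    (fun s => - (2 * kw) * wdot q (fun i => th i s - th' i s)
      (H (fun i => th i s - th' i s)))) => // r /andP[t0r rs].
  have Dr : D r by apply: sub'; rewrite /= in_itv/= t0r.
  have dD i : derivative_in D (fun s => th i s - th' i s) r
      (- kw * H (fun i => th i r - th' i r) i).
    rewrite HB mulrBr; apply: derivative_inB.
      by have [] := hm _ Dr i.
    by have [] := hm' _ Dr i.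
  split; last by rewrite mulNr oppr_le0 mulr_ge0// mulr_ge0// ltW.
  apply: derivative_in_eq (derivative_in_wdot (q := q) (u := fun i s => th i s - th' i s)
    (v := fun i s => th i s - th' i s) dD dD).
  by rewrite /wdot -big_split mulr_sumr; apply: eq_bigr => i _ /=; ring.
suff xyeq : wdot q (fun i => x i t - x' i t) (fun i => x i t - x' i t) +
    wdot q (fun i => y i t - y' i t) (fun i => y i t - y' i t) <= 0.
  have x0 := wdot_ge0 q0 (fun i => x i t - x' i t).
  have y0 := wdot_ge0 q0 (fun i => y i t - y' i t).
  move=> i; split; first by apply: theq; rewrite t0t lexx.
    by apply: (zero (x^~ t) (x'^~ t)); lra.
  by apply: (zero (y^~ t) (y'^~ t)); lra.
have <- : wdot q (fun i => x i t0 - x' i t0) (fun i => x i t0 - x' i t0) +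
    wdot q (fun i => y i t0 - y' i t0) (fun i => y i t0 - y' i t0) = 0.
  by rewrite !wdot00 ?addr0// => i; have [] := h0 i.
apply: (@nonincreasing_derivative_in R D
    (fun s => wdot q (fun i => x i s - x' i s) (fun i => x i s - x' i s) +
      wdot q (fun i => y i s - y' i s) (fun i => y i s - y' i s))
    (fun s => - (2 * kv) * wdot q (fun i => x i s - x' i s)
      (H (fun i => x i s - x' i s)))) => // r /andP[t0r rt].
have Dr : D r by apply: sub; rewrite /= in_itv/= t0r.
split; last by rewrite mulNr oppr_le0 mulr_ge0// mulr_ge0// ltW.
have Hth i : H (th'^~ r) i = H (th^~ r) i.
  by apply: eq_bigr => j _; rewrite theq// t0r.
pose om i := w0 r - kw * H (th^~ r) i.
have dxD i : derivative_in D (fun s => x i s - x' i s) r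
    (- kv * H (fun i => x i r - x' i r) i + om i * (y i r - y' i r)).
  have [_ xi _] := hm _ Dr i; have [_ xi' _] := hm' _ Dr i.
  apply: derivative_in_eq (derivative_inB xi xi').
  by rewrite HB Hth /om; ring.
have dyD i : derivative_in D (fun s => y i s - y' i s) r
    (- om i * (x i r - x' i r)).
  have [_ _ yi] := hm _ Dr i; have [_ _ yi'] := hm' _ Dr i.
  apply: derivative_in_eq (derivative_inB yi yi').
  by rewrite Hth /om; ring.
apply: derivative_in_eq (derivative_inD
  (derivative_in_wdot (q := q) (u := fun i s => x i s - x' i s)
    (v := fun i s => x i s - x' i s) dxD dxD)
  (derivative_in_wdot (q := q) (u := fun i s => y i s - y' i s)
    (v := fun i s => y i s - y' i s) dyD dyD)).
by rewrite /wdot -!big_split mulr_sumr; apply: eq_bigr => i _ /=; ring.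
Qed.

Lemma theta_form_decay (q : 'I_N -> R) (c1 t0 t : R) (D : set R)
    (th x y : 'I_N -> R -> R) :
  (forall u, c1 * wdot q u u <= wdot q u (H u)) ->
  t0 <= t -> `[t0, t]%classic `<=` D -> motion D th x y ->
  wdot q (th^~ t) (th^~ t) <=
    wdot q (th^~ t0) (th^~ t0) * expR (- (2 * kw * c1) * (t - t0)).
Proof.
move=> qP t0t sub hm.
have := @gronwall R D (fun s => wdot q (th^~ s) (th^~ s))
  (fun s => - (2 * kw) * wdot q (th^~ s) (H (th^~ s)))
  (fun s => - (2 * kw * c1) * (s - t0)) (fun=> - (2 * kw * c1)) t0 t t0t sub.
rewrite subrr mulr0 subr0; apply => s st.
have Ds : D s by apply: sub; rewrite /= in_itv.
split; [exact: error_motion_theta_form hm _ Ds|exact: derivative_in_affine|].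
rewrite !mulNr lerN2 -[leLHS]mulrA; apply: ler_wpM2l; first by rewrite mulr_ge0// ltW.
exact: qP.
Qed.

End Decay.

(** * The strict Lyapunov function and the exponential estimate *)

Section ExponentialDecay.
Context {R : realType} {N : nat}.
Variables (edge : rel 'I_N.+1) (a : 'M[R]_(N, N.+1)).
Hypothesis ha : weights_of edge a.
Hypothesis htree : contains_spanning_tree (ord0 : 'I_N.+1) edge.
Variables (kw kv : R) (w0 xt0 yt0 : R -> R).
Hypotheses (hkw : 0 < kw) (hkv : 0 < kv).

Local Notation motion := (error_motion a kw kv w0 xt0 yt0).
Local Notation H := (Hact a).

(** Each [q i] times the square of a component of [H theta] is at most [h] times the weighted form
    of theta, which decays at the rate [2 * kw * c1]. Taking square roots halves the rate. *)
Lemma Hact_theta_decay : exists gam del : R, [/\ 0 <= gam, 0 < del &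
  forall (t0 t : R) (D : set R) (th x y : 'I_N -> R -> R),
    t0 <= t -> `[t0, t]%classic `<=` D -> motion D th x y ->
    forall i, `|H (th^~ t) i| <=
      gam * Num.sqrt (\sum_i th i t0 ^+ 2) * expR (- del * (t - t0))].
Proof.
have [q [c1 [h [q0 c10 h0 qP]]]] := exists_dissipation_form ha htree.
pose Q := \sum_i q i.
have qs0 : 0 <= Q by apply: sumr_ge0 => i _; exact: ltW.
have hq0 i : 0 <= h * Q / q i by rewrite divr_ge0 ?mulr_ge0// ltW.
(* [gam] is at least 1 and at least every [h * Q / q i], so its square dominates them too. *)
pose gam := 1 + \sum_i h * Q / q i.
have gam1 i : h * Q / q i <= gam ^+ 2.
  have g1 : h * Q / q i <= gam.
    rewrite /gam (bigD1 i)//=.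
    have : 0 <= \sum_(k < N | k != i) h * Q / q k by exact: sumr_ge0.
    by lra.
  apply: (le_trans g1); rewrite expr2 ler_peMl//; first exact: le_trans g1.
  by rewrite /gam lerDl sumr_ge0.
have gam0 : 0 <= gam by rewrite /gam addr_ge0// sumr_ge0.
exists gam, (kw * c1); split=> [//||t0 t D th x y t0t sub hm i].
  exact: mulr_gt0.
have r0 : 0 <= \sum_i th i t0 ^+ 2 by apply: sumr_ge0 => j _; exact: sqr_ge0.
have Wt := theta_form_decay hkw (fun u => (qP u).1) t0t sub hm.
have W0 : wdot q (th^~ t0) (th^~ t0) <= Q * \sum_i th i t0 ^+ 2.
  rewrite /wdot mulr_sumr; apply: ler_sum => j _; rewrite -expr2 ler_wpM2r ?sqr_ge0//.
  by rewrite /Q (bigD1 j)//= lerDl sumr_ge0// => k _; exact: ltW.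
have e2 : expR (- (2 * kw * c1) * (t - t0)) = expR (- (kw * c1) * (t - t0)) ^+ 2.
  by rewrite expr2 -expRD; congr expR; ring.
rewrite e2 in Wt.
have gi : H (th^~ t) i ^+ 2 <=
    (gam * Num.sqrt (\sum_i th i t0 ^+ 2) * expR (- (kw * c1) * (t - t0))) ^+ 2.
  rewrite !exprMn sqr_sqrtr// -mulrA.
  have E2 : 0 <= expR (- (kw * c1) * (t - t0)) ^+ 2 by exact: sqr_ge0.
  set E := expR _ ^+ 2 in Wt E2 *.
  apply: (@le_trans _ _ (h * Q / q i * ((\sum_i th i t0 ^+ 2) * E))); last first.
    by apply: ler_wpM2r => //; exact: mulr_ge0.
  rewrite (_ : _ * (_ * E) = h * (Q * (\sum_i th i t0 ^+ 2) * E) / q i); last by ring.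
  rewrite ler_pdivlMr// mulrC; apply: (le_trans (wdot_sqr_le q0 _ i)).
  apply: (le_trans (qP _).2); apply: ler_wpM2l => //; apply: (le_trans Wt).
  exact: ler_wpM2r.
rewrite -ler_sqr ?nnegrE//; first by rewrite real_normK// num_real.
by rewrite !mulr_ge0// ?sqrtr_ge0 ?expR_ge0.
Qed.

Variables (dw0 : R -> R) (wb m : R).
Hypotheses (wb_gt0 : 0 < wb) (m_ge0 : 0 <= m).
Hypothesis w0P : forall t, 0 <= t ->
  [/\ derivative_in `[0, +oo[ w0 t (dw0 t), `|w0 t| <= wb & `|dw0 t| <= wb].
Hypothesis tP : forall t, 0 <= t -> `|xt0 t| <= m /\ `|yt0 t| <= m.
Hypothesis hexc : bounded_exciting w0.

(** [E = U + kap * W] satisfies [E' <= (- lam + k * G) * E], where [G] is the exponentially decaying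
    bound on [H theta]. The integral of [k * G] is proportional to the initial norm, whence the
    factor [expR (c2 * ...)]. *)
Lemma error_motion_decay : exists C c2 lam : R, [/\ 0 <= C, 0 <= c2, 0 < lam &
  forall (t0 : R) (th x y : 'I_N -> R -> R), 0 <= t0 ->
    motion `[t0, +oo[ th x y -> forall t, t0 <= t ->
    sqnorm3 (th^~ t) (x^~ t) (y^~ t) <=
    C * sqnorm3 (th^~ t0) (x^~ t0) (y^~ t0) *
      expR (c2 * Num.sqrt (sqnorm3 (th^~ t0) (x^~ t0) (y^~ t0)) - lam * (t - t0))].
Proof.
have [q [c1 [h [q0 c10 h0 qP]]]] := exists_dissipation_form ha htree.
have [gam [del [gam0 del0 gP]]] := Hact_theta_decay.
have [T [mu [psib [psi [dpsi [T0 mu0 psiP]]]]]] := excitation_window hexc.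
have wb0 := ltW wb_gt0.
have psib0 : 0 <= psib by have [_ /andP[+ +] _] := psiP 0 (lexx 0); exact: le_trans.
pose rhs := 2 * T * wb ^+ 2 + 2 * (T * wb) ^+ 2 / mu + 2 * (T * wb * kv) ^+ 2 * h / mu.
have rhs0 : 0 <= rhs.
  have mui : 0 <= mu^-1 by rewrite invr_ge0 ltW.
  have T0' := ltW T0.
  rewrite /rhs; apply: addr_ge0; [apply: addr_ge0|].
  - by rewrite !mulr_ge0// ltW.
  - by rewrite !mulr_ge0// ltW.
  - by rewrite !mulr_ge0// ltW.
have kvc : 0 < 2 * kv * c1 by rewrite !mulr_gt0.
have Twb : 0 <= T * wb by rewrite mulr_ge0// ltW.
(* The first three summands give [V <= U] despite [psi] and the cross term; the last one makes the
   damping of [x] absorb [rhs]. *)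
pose c := psib + 1 + T * wb + rhs / (2 * kv * c1).
have rk0 : 0 <= rhs / (2 * kv * c1) by rewrite divr_ge0// ltW.
have cbig : rhs <= (c - psib) * (2 * kv * c1).
  rewrite -ler_pdivrMr// /c; lra.
have psic : psib <= c by rewrite /c; lra.
pose B := 2 * c * kw * m + T * wb * kw * m.
pose a4 := 4 * B ^+ 2 / mu.
have a40 : 0 <= a4 by rewrite /a4 divr_ge0 ?(ltW mu0)// mulr_ge0// sqr_ge0.
pose k := T * wb * kw.
have k0 : 0 <= k by rewrite mulr_ge0// ltW.
have kwc : 0 < 2 * kw * c1 by rewrite !mulr_gt0.
(* The decay of [kap * W] pays for the forcing [a4 * h * W] and still leaves [- W]. *)
pose kap := (a4 * h + 1) / (2 * kw * c1).
have kap0 : 0 < kap by rewrite divr_gt0// ltr_wpDl// mulr_ge0.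
pose cu := c + T * wb.
have cu0 : 0 < cu by rewrite /cu /c; lra.
(* Since [U <= cu * V], the first entry gives [lam * U <= mu / 2 * V]; the second gives
   [lam * kap * W <= W]. *)
pose lam := Num.min (mu / (2 * cu)) kap^-1.
have lam0 : 0 < lam.
  by rewrite lt_min invr_gt0 kap0 divr_gt0// mulr_gt0.
have lamcu : lam * cu <= mu / 2.
  have -> : mu / 2 = mu / (2 * cu) * cu by field; rewrite gt_eqF.
  by rewrite ler_pM2r// /lam ge_min lexx.
have lamkap : lam * kap <= 1.
  have <- : kap^-1 * kap = 1 by rewrite mulVf// gt_eqF.
  by rewrite ler_pM2r// /lam ge_min lexx orbT.
pose qs := \sum_i q i; pose qi := \sum_i (q i)^-1.
have qs0 : 0 <= qs by apply: sumr_ge0 => i _; exact: ltW.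
have qi0 : 0 <= qi by apply: sumr_ge0 => i _; rewrite invr_ge0 ltW.
have wdot_le u : wdot q u u <= qs * \sum_i u i ^+ 2.
  rewrite /wdot mulr_sumr; apply: ler_sum => j _; rewrite -expr2 ler_wpM2r ?sqr_ge0//.
  by rewrite /qs (bigD1 j)//= lerDl sumr_ge0// => i _; exact: ltW.
have wdot_ge u : \sum_i u i ^+ 2 <= qi * wdot q u u.
  rewrite /qi mulr_suml; apply: ler_sum => j _.
  by rewrite mulrC ler_pdivlMr// mulrC wdot_sqr_le.
exists (qi * (kap^-1 + 1) * ((cu + kap) * qs)), (k * gam / del), lam.
split=> //.
- by rewrite !mulr_ge0// addr_ge0// ?invr_ge0 ltW.
- by rewrite divr_ge0// ?mulr_ge0// ltW.
move=> t0 th x y t00 hm t t0t.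
set r2 := sqnorm3 (th^~ t0) (x^~ t0) (y^~ t0).
have sqn3E s : sqnorm3 (th^~ s) (x^~ s) (y^~ s) =
    (\sum_i th i s ^+ 2) + (\sum_i x i s ^+ 2) + \sum_i y i s ^+ 2.
  by rewrite /sqnorm3 -!big_split.
have sum0 (u : 'I_N -> R) : 0 <= \sum_i u i ^+ 2.
  by apply: sumr_ge0 => i _; exact: sqr_ge0.
pose V s := wdot q (x^~ s) (x^~ s) + wdot q (y^~ s) (y^~ s).
pose W s := wdot q (th^~ s) (th^~ s).
pose p s := wdot q (x^~ s) (y^~ s).
pose U s := (c - psi s) * V s - T * (w0 s * p s).
pose E s := U s + kap * W s.
have V0 s : 0 <= V s by rewrite addr_ge0// wdot_ge0.
have W0 s : 0 <= W s by exact: wdot_ge0.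
have pV s : 0 <= s -> `|T * (w0 s * p s)| <= T * wb * V s.
  move=> s0; have [_ ws _] := w0P s0.
  rewrite normrM (gtr0_norm T0) -mulrA ler_pM2l//.
  (* Young's inequality with [e = wb] leaves the second coefficient [wb / 4], which is below
     [wb]. *)
  have wpos (d : R) : `|d| <= wb -> d * p s <= wb * V s.
    move=> dwb; apply: (le_trans (wdot_young q0 (x^~ s) (y^~ s) wb_gt0 dwb)).
    rewrite /V mulrDr lerD2l ler_wpM2r ?wdot_ge0//.
    by rewrite ler_pdivrMr ?mulr_gt0// expr2 mulrCA ler_peMl// ?mulr_ge0//; lra.
  rewrite ler_norml; apply/andP; split; last exact: wpos.
  by rewrite lerNl -mulNr; apply: wpos; rewrite normrN.
have VU s : 0 <= s -> V s <= U s.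
  move=> s0; have := pV s s0; rewrite ler_norml => /andP[_ h1].
  have [_ /andP[ps0 psb] _] := psiP s s0.
  have h2 : (1 + T * wb) * V s <= (c - psi s) * V s.
    by rewrite ler_wpM2r// /c; lra.
  by rewrite /U; lra.
have UV s : 0 <= s -> U s <= cu * V s.
  move=> s0; have := pV s s0; rewrite ler_norml => /andP[h1 _].
  have [_ /andP[ps0 psb] _] := psiP s s0.
  have h2 : (c - psi s) * V s <= c * V s by rewrite ler_wpM2r//; lra.
  by rewrite /U /cu; lra.
pose G s := gam * Num.sqrt r2 * expR (- del * (s - t0)).
have G0 s : 0 <= G s by rewrite !mulr_ge0// ?sqrtr_ge0 ?expR_ge0.
have gG s i : t0 <= s -> `|H (th^~ s) i| <= G s.
  move=> t0s.
  have sub : `[t0, s]%classic `<=` `[t0, +oo[%classic by exact: subset_itvl.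
  have := gP _ _ _ _ _ _ t0s sub hm i; move=> /le_trans; apply.
  rewrite /G; apply: ler_wpM2r; first exact: expR_ge0.
  apply: ler_wpM2l => //; rewrite ler_wsqrtr// /r2 sqn3E.
  by have := sum0 (x^~ t0); have := sum0 (y^~ t0); lra.
(* A primitive of the rate [- lam + k * G] for Gronwall's inequality. *)
pose Mf s := - lam * (s - t0) - (k * (gam * Num.sqrt r2) / del) * expR (- del * (s - t0)).
have Et : E t <= E t0 * expR (Mf t - Mf t0).
  pose dV s := - (2 * kv) * wdot q (x^~ s) (H (x^~ s)) +
    2 * kw * (xt0 s * wdot q (y^~ s) (H (th^~ s)) - yt0 s * wdot q (x^~ s) (H (th^~ s))).
  pose e s := \sum_i q i * (H (th^~ s) i * (y i s ^+ 2 - x i s ^+ 2)).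
  pose dp s := - kv * wdot q (y^~ s) (H (x^~ s))
    + w0 s * (wdot q (y^~ s) (y^~ s) - wdot q (x^~ s) (x^~ s)) - kw * e s
    - kw * yt0 s * wdot q (y^~ s) (H (th^~ s)) + kw * xt0 s * wdot q (x^~ s) (H (th^~ s)).
  pose dU s := (0 - dpsi s) * V s + (c - psi s) * dV s
    - T * (dw0 s * p s + w0 s * dp s).
  pose dW s := - (2 * kw) * wdot q (th^~ s) (H (th^~ s)).
  apply: (@gronwall R `[t0, +oo[ E (fun s => dU s + kap * dW s) Mf
    (fun s => - lam - (k * (gam * Num.sqrt r2) / del) * (- del * expR (- del * (s - t0))))) => //.
    exact: subset_itvl.
  move=> s /andP[t0s st].
  have s0 : 0 <= s := le_trans t00 t0s.
  have Ds : `[t0, +oo[%classic s by rewrite /= in_itv/= t0s.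
  have sub0 : `[t0, +oo[%classic `<=` `[0, +oo[%classic.
    by move=> r; rewrite /= !in_itv/= !andbT; exact: le_trans.
  have [wD ws dws] := w0P s0; have [psiD psis dpsis] := psiP s s0.
  have [xts yts] := tP s0.
  split.
  - apply: derivative_inD; last first.
      by apply: derivative_inZ; exact: error_motion_theta_form hm _ Ds.
    apply: derivative_inB.
      apply: derivative_inM; last exact: error_motion_energy hm _ Ds.
      apply: derivative_inB; first exact: derivative_in_cst.
      exact: derivative_in_subset psiD.
    apply: derivative_inZ; apply: derivative_inM; last exact: error_motion_cross hm _ Ds.
    exact: derivative_in_subset wD.
  - apply: derivative_inB; first exact: derivative_in_affine.
    by apply: derivative_inZ; exact: derivative_in_expR_affine.
  have eV : `|e s| <= G s * V s.
    rewrite /e /V; apply: (le_trans (ler_norm_sum _ _ _)).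
    rewrite /wdot -big_split mulr_sumr; apply: ler_sum => i _ /=.
    rewrite -mulrDr [leRHS]mulrCA normrM (gtr0_norm (q0 i)).
    apply: ler_wpM2l; first exact: ltW.
    rewrite normrM; apply: ler_pM => //; first exact: gG.
    apply: (le_trans (ler_normB _ _)); rewrite -!expr2 !ger0_norm ?sqr_ge0//.
    by rewrite addrC.
  have Gam0 := wdot_ge0 q0 (H (th^~ s)).
  have young (d M eps : R) : 0 < eps -> `|d| <= M ->
    [/\ d * p s <= eps * wdot q (y^~ s) (y^~ s) + M ^+ 2 / (4 * eps) * wdot q (x^~ s) (x^~ s),
        d * wdot q (y^~ s) (H (x^~ s)) <= eps * wdot q (y^~ s) (y^~ s) +
          M ^+ 2 / (4 * eps) * wdot q (H (x^~ s)) (H (x^~ s)),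
        d * wdot q (x^~ s) (H (th^~ s)) <= eps * wdot q (x^~ s) (x^~ s) +
          M ^+ 2 / (4 * eps) * wdot q (H (th^~ s)) (H (th^~ s)) &
        d * wdot q (y^~ s) (H (th^~ s)) <= eps * wdot q (y^~ s) (y^~ s) +
          M ^+ 2 / (4 * eps) * wdot q (H (th^~ s)) (H (th^~ s))].
    move=> eps0 dM; split; try exact: wdot_young.
    rewrite (_ : p s = wdot q (y^~ s) (x^~ s)); first exact: wdot_young.
    by apply: eq_bigr => i _; rewrite [x i s * _]mulrC.
  have main := @lyapunov_scalar_estimate R T mu wb m kw kv c1 h psib c (psi s) (dpsi s)
    (w0 s) (dw0 s) (xt0 s) (yt0 s) (G s) (wdot q (x^~ s) (x^~ s))
    (wdot q (y^~ s) (y^~ s)) (wdot q (H (th^~ s)) (H (th^~ s))) (p s)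
    (wdot q (x^~ s) (H (x^~ s))) (wdot q (y^~ s) (H (x^~ s)))
    (wdot q (x^~ s) (H (th^~ s))) (wdot q (y^~ s) (H (th^~ s))) (e s)
    (wdot q (H (x^~ s)) (H (x^~ s))) B T0 mu0 wb0 m_ge0 hkw hkv c10 h0 psis dpsis
    ws dws xts yts (wdot_ge0 q0 _) (wdot_ge0 q0 _) Gam0 (qP _).1 (qP _).2 eV young
    psic cbig erefl.
  have dUle : dU s <= - (mu / 2) * V s + k * G s * V s + a4 * (h * W s).
    apply: (@le_trans _ _ (- (mu / 2) * V s + k * G s * V s +
      a4 * wdot q (H (th^~ s)) (H (th^~ s)))); last first.
      by rewrite lerD2l ler_wpM2l//; exact: (qP _).2.
    apply: le_trans main; rewrite le_eqVlt; apply/orP; left; apply/eqP.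
    by rewrite /dU /dV /dp /V; ring.
  have dWle : kap * dW s <= - (a4 * (h * W s)) - W s.
    rewrite (_ : _ - W s = - (kap * (2 * kw) * (c1 * W s))); last first.
      by rewrite /kap; field; rewrite !gt_eqF.
    have -> : kap * dW s = - (kap * (2 * kw) * wdot q (th^~ s) (H (th^~ s))).
      by rewrite /dW; ring.
    rewrite lerN2; apply: ler_wpM2l; last exact: (qP _).1.
    by rewrite ltW// mulr_gt0// mulr_gt0.
  have kG0 : 0 <= k * G s by rewrite mulr_ge0.
  have -> : - lam - k * (gam * Num.sqrt r2) / del * (- del * expR (- del * (s - t0))) =
      - lam + k * G s by rewrite /G; field; rewrite gt_eqF.
  have VE : V s <= E s.
    apply: (le_trans (VU s s0)); rewrite /E lerDl.
    by rewrite mulr_ge0// ltW.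
  (* Replacing [V] by the larger [E] in the growth term closes the differential inequality in
     [E]. *)
  have kGVE := ler_wpM2l kG0 VE.
  have lamU : lam * U s <= mu / 2 * V s.
    apply: (@le_trans _ _ (lam * (cu * V s))).
      by rewrite ler_wpM2l ?(ltW lam0)//; exact: UV.
    by rewrite mulrA ler_wpM2r.
  have lamW : lam * (kap * W s) <= W s by rewrite mulrA ler_piMl.
  have -> : (- lam + k * G s) * E s = k * G s * E s - lam * U s - lam * (kap * W s).
    by rewrite /E; ring.
  by lra.
have lower : sqnorm3 (th^~ t) (x^~ t) (y^~ t) <= qi * (kap^-1 + 1) * E t.
  have t_ge0 : 0 <= t := le_trans t00 t0t.
  have U0 : 0 <= U t := le_trans (V0 t) (VU t t_ge0).
  apply: (@le_trans _ _ (qi * (W t + V t))).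
    rewrite sqn3E /V !mulrDr -addrA; apply: lerD; first exact: wdot_ge.
    by apply: lerD; exact: wdot_ge.
  rewrite -mulrA ler_wpM2l// mulrDl mul1r; apply: lerD.
    rewrite mulrC ler_pdivlMr// mulrC /E.
    by lra.
  by apply: (le_trans (VU t t_ge0)); rewrite /E lerDl mulr_ge0// ltW.
have upper : E t0 <= (cu + kap) * qs * r2.
  have WS : W t0 <= qs * r2.
    apply: (le_trans (wdot_le _)); rewrite ler_wpM2l// /r2 sqn3E.
    by have := sum0 (x^~ t0); have := sum0 (y^~ t0); lra.
  have VS : V t0 <= qs * r2.
    apply: (le_trans (lerD (wdot_le _) (wdot_le _))); rewrite -mulrDr ler_wpM2l// /r2 sqn3E.
    by have := sum0 (th^~ t0); lra.
  rewrite /E -mulrA mulrDl; apply: lerD; last by rewrite ler_wpM2l// ltW.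
  by apply: (le_trans (UV t0 t00)); rewrite ler_wpM2l// ltW.
have expo : Mf t - Mf t0 <= k * gam / del * Num.sqrt r2 - lam * (t - t0).
  rewrite /Mf subrr !mulr0 expR0 mulr1.
  have : 0 <= k * (gam * Num.sqrt r2) / del * expR (- del * (t - t0)).
    apply: mulr_ge0; last exact: expR_ge0.
    apply: divr_ge0; last exact: ltW.
    by apply: mulr_ge0 => //; apply: mulr_ge0 => //; exact: sqrtr_ge0.
  have -> : k * gam / del * Num.sqrt r2 = k * (gam * Num.sqrt r2) / del by ring.
  by lra.
apply: (le_trans lower); rewrite -!mulrA.
have kk : 0 <= kap^-1 + 1 by rewrite addr_ge0// invr_ge0 ltW.
do 2 (apply: ler_wpM2l => //).
have r20 : 0 <= r2.
  by rewrite /r2 sqn3E; have := sum0 (th^~ t0); have := sum0 (x^~ t0); have := sum0 (y^~ t0); lra.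
apply: (le_trans Et); rewrite !mulrA; apply: ler_pM => //.
- apply: addr_ge0; first exact: le_trans (VU t0 t00).
  by rewrite mulr_ge0// ltW.
- by rewrite ler_expR.
Qed.

End ExponentialDecay.

(** * Existence of solutions *)

Section Existence.
Context {R : realType} {N : nat}.
Variables (edge : rel 'I_N.+1) (a : 'M[R]_(N, N.+1)).
Hypothesis ha : weights_of edge a.
Hypothesis htree : contains_spanning_tree (ord0 : 'I_N.+1) edge.
Variables (kw kv : R) (w0 xt0 yt0 dw0 dxt0 dyt0 : R -> R) (wb m : R).
Hypotheses (hkw : 0 < kw) (hkv : 0 < kv).
Hypotheses (wb_gt0 : 0 < wb) (m_ge0 : 0 <= m).
Hypothesis w0P : forall t, 0 <= t ->
  [/\ derivative_in `[0, +oo[ w0 t (dw0 t), `|w0 t| <= wb & `|dw0 t| <= wb].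
Hypothesis tP : forall t, 0 <= t -> `|xt0 t| <= m /\ `|yt0 t| <= m.
Hypothesis dtP : forall t, 0 <= t ->
  derivative_in `[0, +oo[ xt0 t (dxt0 t) /\ derivative_in `[0, +oo[ yt0 t (dyt0 t).

Local Notation H := (Hact a).

(** Theta solves a linear equation with constant coefficients. With theta known and [H theta]
    bounded, the equations of [(x, y)] are linear with continuous bounded coefficients. *)
Lemma error_motion_exists (t0 : R) (thi xi yi : 'I_N -> R) : 0 <= t0 ->
  exists th x y : 'I_N -> R -> R,
    [/\ forall i, [/\ th i t0 = thi i, x i t0 = xi i & y i t0 = yi i] &
        error_motion a kw kv w0 xt0 yt0 `[t0, +oo[ th x y].
Proof.
move=> t00.
pose L0 := \sum_i \sum_j `|Hmx a i j|.
have L00 : 0 <= L0 by apply: sumr_ge0 => i _; exact: sumr_ge0.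
have HL i j : `|Hmx a i j| <= L0.
  rewrite /L0 (bigD1 i)//= (bigD1 j)//= -addrA lerDl addr_ge0//; first exact: sumr_ge0.
  by apply: sumr_ge0 => k _; exact: sumr_ge0.
have [||||||th [th0 thD]] := @linear_ode_exists R 'I_N
    (fun _ i j => - kw * Hmx a i j) (fun _ _ => 0) (kw * L0) 0 t0 thi.
- by rewrite mulr_ge0// ltW.
- by [].
- by move=> i j t; exact: cvg_cst.
- by move=> i t; exact: cvg_cst.
- by move=> _ i j; rewrite normrM normrN (gtr0_norm hkw) ler_pM2l.
- by move=> *; rewrite normr0.
have {}thD i t : t0 <= t -> derivative_in `[t0, +oo[ (th i) t (- kw * H (th^~ t) i).
  move=> t0t; apply: derivative_in_eq (thD i t t0t).
  by rewrite addr0 /Hact mulr_sumr; apply: eq_bigr => j _; rewrite mulrA.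
(* The decay of theta does not depend on w0, xt0 and yt0: replace them by 0,
   so that x = y = 0 completes theta into a motion. *)
have hm0 : error_motion a kw kv (fun=> 0) (fun=> 0) (fun=> 0) `[t0, +oo[ th
    (fun _ _ => 0) (fun _ _ => 0).
  move=> t; rewrite /= in_itv/= andbT => t0t i; split; first exact: thD.
    apply: derivative_in_eq (derivative_in_cst _ _ _).
    by rewrite {1}/Hact big1 => [|j _]; rewrite ?mulr0//; ring.
  by apply: derivative_in_eq (derivative_in_cst _ _ _); ring.
have [gam [del [gam0 del0 gP]]] :=
  Hact_theta_decay ha htree kv (fun=> 0) (fun=> 0) (fun=> 0) hkw.
pose Gb := gam * Num.sqrt (\sum_i th i t0 ^+ 2).
have Gb0 : 0 <= Gb by rewrite mulr_ge0// sqrtr_ge0.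
have gb i t : t0 <= t -> `|H (th^~ t) i| <= Gb.
  move=> t0t; have sub : `[t0, t]%classic `<=` `[t0, +oo[%classic by exact: subset_itvl.
  have := gP _ _ _ _ _ _ t0t sub hm0 i => /le_trans; apply.
  rewrite ler_piMr// -expR0 ler_expR mulNr oppr_le0 mulr_ge0 ?subr_ge0//.
  exact: ltW.
(* Time is frozen before [t0] so that the coefficients are continuous and bounded on the whole
   line. *)
pose tm (t : R) := Num.max t t0.
have tmP t : t0 <= tm t by rewrite /tm le_max lexx orbT.
have tm0 t : 0 <= tm t := le_trans t00 (tmP t).
have sub0 : `[t0, +oo[%classic `<=` `[0, +oo[%classic.
  by move=> r; rewrite /= !in_itv/= !andbT; exact: le_trans.
have wC : continuous (fun t => w0 (tm t)).
  apply: (@continuous_max_comp R w0 dw0) => t t0t; apply: derivative_in_subset sub0 _.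
  by have [] := w0P (le_trans t00 t0t).
have xtC : continuous (fun t => xt0 (tm t)).
  apply: (@continuous_max_comp R xt0 dxt0) => t t0t; apply: derivative_in_subset sub0 _.
  by have [] := dtP (le_trans t00 t0t).
have ytC : continuous (fun t => yt0 (tm t)).
  apply: (@continuous_max_comp R yt0 dyt0) => t t0t; apply: derivative_in_subset sub0 _.
  by have [] := dtP (le_trans t00 t0t).
pose g i t := H (th^~ t) i.
have gC i : continuous (fun t => g i (tm t)).
  apply: (@continuous_max_comp R (g i)
    (fun t => \sum_j Hmx a i j * (- kw * H (th^~ t) j))) => t t0t.
  apply: (derivative_in_sum (f := fun j s => Hmx a i j * th j s)) => j.
  by apply: derivative_inZ; exact: thD.
pose om i t := w0 t - kw * g i t.
have omC i : continuous (fun t => om i (tm t)).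
  move=> t; apply: cvgB; first exact: wC.
  by apply: cvgM; [exact: cvg_cst|exact: gC].
(* The left copy of the indices carries [x] and the right copy [y]; the mixed blocks are diagonal
   and hold the rotation. *)
pose A (t : R) (i j : 'I_N + 'I_N) : R := match i, j with
  | inl i, inl j => - kv * Hmx a i j
  | inl i, inr j => if i == j then om i (tm t) else 0
  | inr i, inl j => if i == j then - om i (tm t) else 0
  | inr _, inr _ => 0 end.
pose b (t : R) (i : 'I_N + 'I_N) : R := match i with
  | inl i => - kw * yt0 (tm t) * g i (tm t)
  | inr i => kw * xt0 (tm t) * g i (tm t) end.
have omB i t : `|om i (tm t)| <= wb + kw * Gb.
  apply: (le_trans (ler_normB _ _)); apply: lerD; first by have [] := w0P (tm0 t).
  by rewrite normrM (gtr0_norm hkw) ler_pM2l//; exact: gb.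
have kvL : 0 <= kv * L0 by rewrite mulr_ge0// ltW.
have kwG : 0 <= kw * Gb by rewrite mulr_ge0// ltW.
have wG : 0 <= wb + kw * Gb by rewrite addr_ge0// ltW.
have bB' (s : R) i t : `|s| <= m -> `|kw * s * g i (tm t)| <= kw * m * Gb.
  move=> sm; rewrite !normrM (gtr0_norm hkw) -!mulrA ler_pM2l//.
  by apply: ler_pM => //; exact: gb.
have [||||||z [z0 zD]] := @linear_ode_exists R ('I_N + 'I_N)%type A b
    (kv * L0 + (wb + kw * Gb)) (kw * m * Gb) t0
    (fun i => match i with inl i => xi i | inr i => yi i end).
- exact: addr_ge0.
- by rewrite !mulr_ge0// ltW.
- move=> [i|i] [j|j] t; rewrite /A; try exact: cvg_cst; case: eqP => _; try exact: cvg_cst.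
    exact: omC.
  by apply: cvgN; exact: omC.
- move=> [i|i] t; rewrite /b; (apply: cvgM; last exact: gC);
    by apply: cvgM; [exact: cvg_cst|first [exact: ytC|exact: xtC]].
- move=> t [i|i] [j|j]; rewrite /A.
  + rewrite normrM normrN (gtr0_norm hkv); apply: (@le_trans _ _ (kv * L0)).
      by rewrite ler_pM2l.
    by rewrite lerDl.
  + case: eqP => _; last by rewrite normr0 addr_ge0.
    by apply: (le_trans (omB i t)); rewrite lerDr.
  + case: eqP => _; last by rewrite normr0 addr_ge0.
    by rewrite normrN; apply: (le_trans (omB i t)); rewrite lerDr.
  + by rewrite normr0 addr_ge0.
- move=> t [i|i]; rewrite /b; last by apply: bB'; have [] := tP (tm0 t).
  by rewrite !mulNr normrN; apply: bB'; have [] := tP (tm0 t).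
exists th, (fun i => z (inl i)), (fun i => z (inr i)); split.
  by move=> i; rewrite th0 !z0.
move=> t; rewrite /= in_itv/= andbT => t0t i.
have tmt : tm t = t by rewrite /tm; exact/max_idPl.
split; first exact: thD.
- apply: derivative_in_eq (zD (inl i) t t0t).
  rewrite big_sumType/= (bigD1 i (P := xpredT) (F := fun j => (if i == j then _ else _) * _))//=.
  rewrite eqxx tmt [X in _ + (_ + X)]big1 ?addr0; last first.
    by move=> j ji; rewrite eq_sym (negbTE ji) mul0r.
  rewrite /om /g -/(H _ i) /Hact !mulr_sumr.
  under eq_bigr do rewrite -mulrA.
  by rewrite -!mulr_sumr; ring.
- apply: derivative_in_eq (zD (inr i) t t0t).
  rewrite big_sumType/= [X in _ + X + _]big1; last by move=> j _; rewrite mul0r.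
  rewrite (bigD1 i)//= eqxx tmt big1 ?addr0; last first.
    by move=> j ji; rewrite eq_sym (negbTE ji) mul0r.
  by rewrite /om /g.
Qed.

End Existence.

(** * Stacked states and stability of the error system *)

Section StackedState.
Context {R : realType} {N : nat}.

Definition part1 (z : R -> 'cV[R]_(N + (N + N))) (i : 'I_N) (t : R) : R :=
  usubmx (z t) i 0.
Definition part2 (z : R -> 'cV[R]_(N + (N + N))) (i : 'I_N) (t : R) : R :=
  usubmx (dsubmx (z t)) i 0.
Definition part3 (z : R -> 'cV[R]_(N + (N + N))) (i : 'I_N) (t : R) : R :=
  dsubmx (dsubmx (z t)) i 0.
Definition stack3 (u v w : 'I_N -> R -> R) (t : R) : 'cV[R]_(N + (N + N)) :=
  col_mx (\col_i u i t) (col_mx (\col_i v i t) (\col_i w i t)).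

Lemma part1_stack3 u v w : part1 (stack3 u v w) = u.
Proof. by apply/funext => i; apply/funext => t; rewrite /part1 col_mxKu mxE. Qed.

Lemma part2_stack3 u v w : part2 (stack3 u v w) = v.
Proof.
by apply/funext => i; apply/funext => t; rewrite /part2 col_mxKd col_mxKu mxE.
Qed.

Lemma part3_stack3 u v w : part3 (stack3 u v w) = w.
Proof.
by apply/funext => i; apply/funext => t; rewrite /part3 !col_mxKd mxE.
Qed.

Lemma stacked_eq (z z' : R -> 'cV[R]_(N + (N + N))) t :
  (forall i, [/\ part1 z i t = part1 z' i t, part2 z i t = part2 z' i t &
    part3 z i t = part3 z' i t]) -> z t = z' t.
Proof.
move=> h; rewrite -(vsubmxK (z t)) -(vsubmxK (z' t)).
rewrite -(vsubmxK (dsubmx (z t))) -(vsubmxK (dsubmx (z' t))).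
by congr col_mx; [|congr col_mx]; apply/colP => i; have [] := h i.
Qed.

Lemma enorm_stacked z t :
  enorm (z t) = Num.sqrt (sqnorm3 (part1 z^~ t) (part2 z^~ t) (part3 z^~ t)).
Proof.
rewrite /enorm; congr Num.sqrt.
rewrite big_split_ord big_split_ord /sqnorm3 !big_split/= addrA.
by congr (_ + _ + _); apply: eq_bigr => i _; rewrite /part1 /part2 /part3 !mxE.
Qed.

Lemma solution_on_stacked (f : R -> 'cV[R]_(N + (N + N)) -> 'cV[R]_(N + (N + N)))
    (D : set R) z :
  solution_on f D z <-> forall t, D t -> forall i,
    [/\ derivative_in D (part1 z i) t (usubmx (f t (z t)) i 0),
        derivative_in D (part2 z i) t (usubmx (dsubmx (f t (z t))) i 0) &
        derivative_in D (part3 z i) t (dsubmx (dsubmx (f t (z t))) i 0)].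
Proof.
have e1 i : (fun s => z s (lshift (N + N) i) 0) = part1 z i.
  by apply/funext => s; rewrite /part1 mxE.
have e2 i : (fun s => z s (rshift N (lshift N i)) 0) = part2 z i.
  by apply/funext => s; rewrite /part2 !mxE.
have e3 i : (fun s => z s (rshift N (rshift N i)) 0) = part3 z i.
  by apply/funext => s; rewrite /part3 !mxE.
split=> [h t Dt i|h t Dt i].
  by rewrite -e1 -e2 -e3 !mxE; split; exact: h.
case: (split_ordP i) => [j ->|k ->].
  by rewrite e1; have [+ _ _] := h t Dt j; rewrite mxE.
case: (split_ordP k) => [j ->|j ->].
  by rewrite e2; have [_ + _] := h t Dt j; rewrite !mxE.
by rewrite e3; have [_ _ +] := h t Dt j; rewrite !mxE.
Qed.

Variables (a : 'M[R]_(N, N.+1)) (kw kv : R) (w0 x0 y0 theta0 : R -> R).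

Lemma Hmx_mulE (u : 'cV[R]_N) i : (Hmx a *m u) i 0 = Hact a (u^~ 0) i.
Proof. by rewrite mxE. Qed.

Lemma diag_Hmx_mulE (d u : 'cV[R]_N) i :
  (diag_mx d^T *m Hmx a *m u) i 0 = d i 0 * Hact a (u^~ 0) i.
Proof. by rewrite -mulmxA mul_diag_mx [LHS]mxE Hmx_mulE mxE. Qed.

Lemma error_system_motion D z :
  solution_on (error_system a kw kv w0 x0 y0 theta0) D z <->
  error_motion a kw kv w0 (fun t => xtilde (x0 t) (y0 t) (theta0 t))
    (fun t => ytilde (x0 t) (y0 t) (theta0 t)) D (part1 z) (part2 z) (part3 z).
Proof.
suff E t i : let g := Hact a (part1 z^~ t) i in
    [/\ usubmx (error_system a kw kv w0 x0 y0 theta0 t (z t)) i 0 = - kw * g,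
      usubmx (dsubmx (error_system a kw kv w0 x0 y0 theta0 t (z t))) i 0 =
        - kv * Hact a (part2 z^~ t) i + (w0 t - kw * g) * part3 z i t
        - kw * ytilde (x0 t) (y0 t) (theta0 t) * g &
      dsubmx (dsubmx (error_system a kw kv w0 x0 y0 theta0 t (z t))) i 0 =
        - (w0 t - kw * g) * part2 z i t + kw * xtilde (x0 t) (y0 t) (theta0 t) * g].
  rewrite solution_on_stacked.
  by split=> h t Dt i; have [h1 h2 h3] := h t Dt i; have [e1 e2 e3] := E t i;
    split; rewrite ?e1 ?e2 ?e3// -?e1 -?e2 -?e3.
rewrite /error_system !(col_mxKu, col_mxKd) /=.
have := Hmx_mulE (usubmx (z t)) i; have := Hmx_mulE (usubmx (dsubmx (z t))) i.
have := diag_Hmx_mulE (dsubmx (dsubmx (z t))) (usubmx (z t)) i.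
have := diag_Hmx_mulE (usubmx (dsubmx (z t))) (usubmx (z t)) i.
rewrite -/(part2 z i t) -/(part3 z i t).
rewrite -[Hact a _ i]/(Hact a (part1 z^~ t) i).
rewrite -[Hact a ((usubmx (dsubmx _))^~ 0) i]/(Hact a (part2 z^~ t) i).
have : usubmx (dsubmx (z t)) i 0 = part2 z i t by [].
have : dsubmx (dsubmx (z t)) i 0 = part3 z i t by [].
(* The products are made opaque so that [mxE] does not expand them into sums; their entries are
   known from the equations. *)
move: (diag_mx _ *m _ *m _) => P1; move: (diag_mx _ *m _ *m _) => P2.
move: (Hmx a *m _) => P3; move: (Hmx a *m _) => P4.
move: (dsubmx (dsubmx _)) => P5; move: (usubmx _) => P6 e5 e6 e1 e2 e3 e4 /=.
by split; rewrite !mxE ?e1 ?e2 ?e3 ?e4 ?e5 ?e6//; ring.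
Qed.

End StackedState.

(** * A class KL function of exponential type *)

Section ExponentialKL.
Context {R : realType}.

Lemma expR_decay_cvg0 (K l : R) : 0 < l -> K * expR (- l * t) @[t --> +oo] --> 0.
Proof.
move=> l0; rewrite -(mulr0 K); apply: cvgM; first exact: cvg_cst.
have lt_oo : l * t @[t --> +oo] --> +oo.
  apply/cvgryPge => A; apply: filterS (nbhs_pinfty_ge (num_real (l^-1 * A))) => t.
  by rewrite ler_pdivrMl.
rewrite (_ : (fun t => expR (- l * t)) = (fun t => expR (- t)) \o (fun t => l * t)).
  exact: cvg_comp lt_oo (@cvgr_expR R).
by apply/funext => t /=; rewrite mulNr.
Qed.

Lemma class_KL_exp (C c l : R) : 0 < C -> 0 <= c -> 0 < l ->
  class_KL (fun r s => C * r * expR (c * r - l * s)).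
Proof.
move=> C0 c0 l0; split.
- apply: continuous_subspaceT => p; apply: cvgM.
    by apply: cvgM; [exact: cvg_cst|exact: cvg_fst].
  apply: (cvg_comp (fun p : R * R => c * p.1 - l * p.2) expR); last exact: continuous_expR.
  apply: cvgB; apply: cvgM; [exact: cvg_cst|exact: cvg_fst|exact: cvg_cst|exact: cvg_snd].
- by move=> s s0; rewrite mulr0 mul0r.
- move=> s r1 r2 s0 r10 r12.
  apply: (@le_lt_trans _ _ (C * r1 * expR (c * r2 - l * s))).
    apply: ler_wpM2l; first by rewrite mulr_ge0// ltW.
    by rewrite ler_expR lerD2r ler_wpM2l// ltW.
  by rewrite ltr_pM2r ?expR_gt0// ltr_pM2l.
- move=> r s1 s2 r0 s10 s12; apply: ler_wpM2l; first by rewrite mulr_ge0// ltW.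
  by rewrite ler_expR lerD2l lerN2 ler_wpM2l// ltW.
- move=> r r0.
  rewrite (_ : (fun s => _) = (fun s => C * r * expR (c * r) * expR (- l * s))).
    exact: expR_decay_cvg0.
  by apply/funext => s; rewrite expRD mulrA mulNr.
Qed.

End ExponentialKL.

(** * Unicycle kinematics in the transformed coordinates *)

Section Tilde.
Context {R : realType}.
Variables (D : set R) (x y th : R -> R) (t dx dy dth : R).
Hypotheses (xD : derivative_in D x t dx) (yD : derivative_in D y t dy)
  (thD : derivative_in D th t dth).

Let cosD : derivative_in D (fun s => cos (th s)) t (- sin (th t) * dth).
Proof. exact: (derivative_in_comp thD (is_derive_cos _)). Qed.

Let sinD : derivative_in D (fun s => sin (th s)) t (cos (th t) * dth).
Proof. exact: (derivative_in_comp thD (is_derive_sin _)). Qed.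

Lemma derivative_in_xtilde :
  derivative_in D (fun s => xtilde (x s) (y s) (th s)) t
    (dx * cos (th t) + dy * sin (th t) + dth * ytilde (x t) (y t) (th t)).
Proof.
apply: derivative_in_eq
  (derivative_inD (derivative_inM xD cosD) (derivative_inM yD sinD)).
by rewrite /ytilde; ring.
Qed.

Lemma derivative_in_ytilde :
  derivative_in D (fun s => ytilde (x s) (y s) (th s)) t
    (- dx * sin (th t) + dy * cos (th t) - dth * xtilde (x t) (y t) (th t)).
Proof.
apply: derivative_in_eq (derivative_inD
  (derivative_inM (derivative_inN xD) sinD) (derivative_inM yD cosD)).
by rewrite /xtilde; ring.
Qed.

End Tilde.

(** In the frame turning with the robot the velocity points along the first axis, so [v] enters only
    the first equation; [w] acts as a rotation. *)
Lemma unicycle_tilde (R : realType) (D : set R) (x y th : R -> R) (t v w : R) :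
  derivative_in D x t (v * cos (th t)) -> derivative_in D y t (v * sin (th t)) ->
  derivative_in D th t w ->
  derivative_in D (fun s => xtilde (x s) (y s) (th s)) t
    (v + w * ytilde (x t) (y t) (th t)) /\
  derivative_in D (fun s => ytilde (x s) (y s) (th s)) t
    (- w * xtilde (x t) (y t) (th t)).
Proof.
move=> xD yD thD; split.
  apply: derivative_in_eq (derivative_in_xtilde xD yD thD).
  by rewrite -!mulrA -mulrDr -!expr2 cos2Dsin2 mulr1.
by apply: derivative_in_eq (derivative_in_ytilde xD yD thD); ring.
Qed.

(** * Completeness and uniform stability of the error system *)

Section ErrorSystem.
Context {R : realType} {N : nat}.
Variables (edge : rel 'I_N.+1) (a : 'M[R]_(N, N.+1)).
Hypothesis ha : weights_of edge a.
Variables (v0 w0 x0 y0 theta0 : R -> R).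
Hypothesis hleader : leader_motion v0 w0 x0 y0 theta0.
Variables (kw kv : R).
Hypotheses (hkw : 0 < kw) (hkv : 0 < kv).
Hypothesis hbounded : leader_bounded x0 y0.
Hypothesis hw0 : bounded_exciting w0.
Hypothesis htree : contains_spanning_tree (ord0 : 'I_N.+1) edge.

Local Notation xt0 := (fun t => xtilde (x0 t) (y0 t) (theta0 t)).
Local Notation yt0 := (fun t => ytilde (x0 t) (y0 t) (theta0 t)).
Local Notation motion := (error_motion a kw kv w0 xt0 yt0).

Lemma leader_speed_bound : exists wb : R, exists2 dw0 : R -> R, 0 < wb &
  forall t, 0 <= t ->
    [/\ derivative_in `[0, +oo[ w0 t (dw0 t), `|w0 t| <= wb & `|dw0 t| <= wb].
Proof.
have [[wb wb0 wP] _] := hw0.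
have /choice[d dP] : forall t, exists d, 0 <= t ->
    [/\ derivative_in `[0, +oo[ w0 t d, `|w0 t| <= wb & `|d| <= wb].
  move=> t; have [t0|] := leP 0 t; last by exists 0.
  by have [wt [d dP db]] := wP t t0; exists d.
by exists wb, d.
Qed.

Lemma leader_tilde_bound : exists2 m : R, 0 <= m &
  forall t, 0 <= t -> `|xt0 t| <= m /\ `|yt0 t| <= m.
Proof.
have [M M0 MP] := hbounded; exists (2 * M) => [|t t0]; first by rewrite mulr_ge0// ltW.
have [xM yM] := MP t t0.
have b (u s : R) : `|u| <= M -> `|s| <= 1 -> `|u * s| <= M.
  by move=> uM s1; rewrite normrM -[M]mulr1; exact: ler_pM.
have c1 : `|cos (theta0 t)| <= 1 by rewrite ler_norml cos_geN1 cos_le1.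
have s1 : `|sin (theta0 t)| <= 1 by rewrite ler_norml sin_geN1 sin_le1.
rewrite /xtilde /ytilde mulr_natl mulr2n.
by split; apply: (le_trans (ler_normD _ _)); apply: lerD; apply: b; rewrite ?normrN.
Qed.

Lemma leader_tilde_motion D t : D `<=` `[0, +oo[ -> D t ->
  derivative_in D xt0 t (v0 t + w0 t * yt0 t) /\
  derivative_in D yt0 t (- w0 t * xt0 t).
Proof.
move=> sub Dt; have := sub _ Dt; rewrite /= in_itv/= andbT => t0.
have [xD yD thD] := hleader t0.
by apply: unicycle_tilde; exact: derivative_in_subset sub _.
Qed.

Lemma error_motion_of_state (t0 : R) (thi xi yi : 'I_N -> R) : 0 <= t0 ->
  exists th x y : 'I_N -> R -> R,
    (forall i, [/\ th i t0 = thi i, x i t0 = xi i & y i t0 = yi i]) /\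
    motion `[t0, +oo[ th x y.
Proof.
move=> t00; have [wb [dw0 wb0 wP]] := leader_speed_bound.
have [m m0 mP] := leader_tilde_bound.
have dP t : 0 <= t -> derivative_in `[0, +oo[ xt0 t (v0 t + w0 t * yt0 t) /\
    derivative_in `[0, +oo[ yt0 t (- w0 t * xt0 t).
  by move=> t0'; apply: leader_tilde_motion; rewrite //= in_itv/= t0'.
have [th [x [y [h1 h2]]]] :=
  error_motion_exists ha htree hkw hkv wb0 m0 wP mP dP thi xi yi t00.
by exists th, x, y.
Qed.

Lemma error_motion_subset D D' th x y :
  D' `<=` D -> motion D th x y -> motion D' th x y.
Proof.
move=> sub h t Dt i; have [h1 h2 h3] := h t (sub _ Dt) i.
by split; exact: derivative_in_subset sub _.
Qed.

(** The global motion from the same state at [t0] is the continuation: uniqueness on each [[t0, t]]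
    with [t < t1] identifies it with the given one. *)
Lemma error_motion_extend (t0 t1 : R) th x y : 0 <= t0 -> t0 < t1 ->
  motion `[t0, t1[ th x y ->
  exists th' x' y' : 'I_N -> R -> R, motion `[t0, +oo[ th' x' y' /\
    forall t, t0 <= t < t1 -> forall i,
      [/\ th' i t = th i t, x' i t = x i t & y' i t = y i t].
Proof.
move=> t00 t01 h.
have [th' [x' [y' [h0 h']]]] :=
  error_motion_of_state (th^~ t0) (x^~ t0) (y^~ t0) t00.
exists th', x', y'; split=> // t /andP[t0t tt1].
have sub : `[t0, t1[%classic `<=` `[t0, +oo[%classic by exact: subset_itvl.
apply: (error_motion_unique ha htree hkw hkv t0t _ (error_motion_subset sub h') h h0).
by move=> s; rewrite /= !in_itv/= => /andP[-> st]; exact: le_lt_trans tt1.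
Qed.

Lemma error_motion_bound : exists C c l : R, [/\ 0 < C, 0 <= c, 0 < l &
  forall (t0 : R) th x y, 0 <= t0 -> motion `[t0, +oo[ th x y ->
    forall t, t0 <= t ->
    Num.sqrt (sqnorm3 (th^~ t) (x^~ t) (y^~ t)) <=
    C * Num.sqrt (sqnorm3 (th^~ t0) (x^~ t0) (y^~ t0)) *
      expR (c * Num.sqrt (sqnorm3 (th^~ t0) (x^~ t0) (y^~ t0)) - l * (t - t0))].
Proof.
have [wb [dw0 wb0 wP]] := leader_speed_bound.
have [m m0 mP] := leader_tilde_bound.
have [C [c [l [C0 c0 l0 hP]]]] :=
  error_motion_decay ha htree hkw hkv wb0 m0 wP mP hw0.
(* Square roots halve the exponent; adding 1 makes the constant positive, as strict monotonicity in
   class KL requires. *)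
exists (Num.sqrt C + 1), (c / 2), (l / 2); split.
- by rewrite ltr_wpDl// sqrtr_ge0.
- by rewrite divr_ge0.
- by rewrite divr_gt0.
move=> t0 th x y t00 h t t0t; have := hP t0 th x y t00 h t t0t.
set r2 := sqnorm3 (th^~ t0) _ _; set e := c * _ - _ => le2.
have r20 : 0 <= r2 by apply: sumr_ge0 => i _; rewrite !addr_ge0 ?sqr_ge0.
have -> : c / 2 * Num.sqrt r2 - l / 2 * (t - t0) = e / 2 by rewrite /e; field.
have ee : expR (e / 2) ^+ 2 = expR e by rewrite expr2 -expRD; congr expR; field.
apply: (@le_trans _ _ (Num.sqrt C * Num.sqrt r2 * expR (e / 2))).
  rewrite -[expR _]ger0_norm ?expR_ge0// -sqrtr_sqr ee -!sqrtrM// ?mulr_ge0//.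
  exact: ler_wsqrtr.
by rewrite ler_wpM2r ?expR_ge0// ler_wpM2r ?sqrtr_ge0// lerDl.
Qed.

Lemma error_system_UGAS : UGAS (error_system a kw kv w0 x0 y0 theta0).
Proof.
split; first split.
- move=> t0 z0 t00.
  have [th [x [y [h0 h]]]] := error_motion_of_state
    ((part1 (cst z0))^~ t0) ((part2 (cst z0))^~ t0) ((part3 (cst z0))^~ t0) t00.
  exists (stack3 th x y).
    rewrite -[RHS]/(cst z0 t0); apply: stacked_eq => i.
    by rewrite part1_stack3 part2_stack3 part3_stack3; exact: h0.
  by apply/error_system_motion; rewrite part1_stack3 part2_stack3 part3_stack3.
- move=> t0 t1 z t00 t01 /error_system_motion h.
  have [th [x [y [h' e]]]] := error_motion_extend t00 t01 h.
  exists (stack3 th x y).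
    by apply/error_system_motion; rewrite part1_stack3 part2_stack3 part3_stack3.
  move=> t tt; apply: stacked_eq => i.
  by rewrite part1_stack3 part2_stack3 part3_stack3; exact: e.
- have [C [c [l [C0 c0 l0 hP]]]] := error_motion_bound.
  exists (fun r s => C * r * expR (c * r - l * s)); first exact: class_KL_exp.
  move=> t0 z t00 /error_system_motion h t t0t.
  by rewrite !enorm_stacked; exact: hP.
Qed.

End ErrorSystem.

(** * The follower robots *)

Section Followers.
Context {R : realType} {N : nat}.
Variables (edge : rel 'I_N.+1) (a : 'M[R]_(N, N.+1)).
Hypothesis ha : weights_of edge a.
Variables (v0 w0 x0 y0 theta0 : R -> R).
Hypothesis hleader : leader_motion v0 w0 x0 y0 theta0.
Variables (kw kv : R).

Local Notation xt0 := (fun t => xtilde (x0 t) (y0 t) (theta0 t)).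
Local Notation yt0 := (fun t => ytilde (x0 t) (y0 t) (theta0 t)).
Local Notation motion := (error_motion a kw kv w0 xt0 yt0).

Definition theta_error (TH : 'I_N -> R -> R) i t := TH i t - theta0 t.
Definition x_error (X Y TH : 'I_N -> R -> R) i t :=
  xtilde (X i t) (Y i t) (TH i t) - xt0 t.
Definition y_error (X Y TH : 'I_N -> R -> R) i t :=
  ytilde (X i t) (Y i t) (TH i t) - yt0 t.

Definition theta_of_error (th : 'I_N -> R -> R) i t := th i t + theta0 t.
(** Together with [y_of_error], the inverse change of coordinates: the transformed position, error
    plus leader, is rotated by the follower's own angle. *)
Definition x_of_error (th x y : 'I_N -> R -> R) i t :=
  (x i t + xt0 t) * cos (theta_of_error th i t) -
  (y i t + yt0 t) * sin (theta_of_error th i t).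
Definition y_of_error (th x y : 'I_N -> R -> R) i t :=
  (x i t + xt0 t) * sin (theta_of_error th i t) +
  (y i t + yt0 t) * cos (theta_of_error th i t).

Definition follower_motion (D : set R) (X Y TH : 'I_N -> R -> R) : Prop :=
  forall t, D t -> forall i,
  let v := - kv * Hact a ((x_error X Y TH)^~ t) i + v0 t in
  let w := - kw * Hact a ((theta_error TH)^~ t) i + w0 t in
  [/\ derivative_in D (X i) t (v * cos (TH i t)),
      derivative_in D (Y i) t (v * sin (TH i t)) & derivative_in D (TH i) t w].

Lemma follower_system_motion D z :
  solution_on (follower_system a kw kv v0 w0 x0 y0 theta0) D z <->
  follower_motion D (part1 z) (part2 z) (part3 z).
Proof.
rewrite solution_on_stacked.
suff E t i :
    v_control a kv (v0 t) (x0 t) (y0 t) (theta0 t) (follower_x (z t))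
      (follower_y (z t)) (follower_theta (z t)) i =
    - kv * Hact a ((x_error (part1 z) (part2 z) (part3 z))^~ t) i + v0 t /\
    omega_control a kw (w0 t) (theta0 t) (follower_theta (z t)) i =
    - kw * Hact a ((theta_error (part3 z))^~ t) i + w0 t.
  by split=> h t Dt i; have := h t Dt i; have [e1 e2] := E t i;
    rewrite /follower_system !(col_mxKu, col_mxKd) ![(\col__ _) _ _]mxE e1 e2.
split.
  congr (_ * _ + _); rewrite (Hmx_consensus ha (fun j => xtilde
    (with_leader (x0 t) (follower_x (z t)) j) (with_leader (y0 t) (follower_y (z t)) j)
    (with_leader (theta0 t) (follower_theta (z t)) j))).
  by apply: eq_bigr => j _; rewrite !with_leader_lift !with_leader0.
congr (_ * _ + _); rewrite (Hmx_consensus ha (with_leader _ _)).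
by apply: eq_bigr => j _; rewrite with_leader_lift with_leader0.
Qed.

(** The input [v0] occurs in the derivatives of both the follower's and the leader's first
    transformed coordinate, and cancels in the difference. *)
Lemma follower_to_error D X Y TH : D `<=` `[0, +oo[ -> follower_motion D X Y TH ->
  motion D (theta_error TH) (x_error X Y TH) (y_error X Y TH).
Proof.
move=> sub h t Dt i; have [XD YD THD] := h t Dt i.
have [xt yt] := unicycle_tilde XD YD THD.
have [xt0D yt0D] := leader_tilde_motion hleader sub Dt.
have t0 : 0 <= t by have := sub _ Dt; rewrite /= in_itv/= andbT.
have [_ _ /(derivative_in_subset sub) th0D] := hleader t0.
split.
- by apply: derivative_in_eq (derivative_inB THD th0D); ring.
- by apply: derivative_in_eq (derivative_inB xt xt0D); rewrite /y_error; ring.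
- by apply: derivative_in_eq (derivative_inB yt yt0D); rewrite /x_error; ring.
Qed.

Lemma of_errorK X Y TH i t :
  [/\ theta_of_error (theta_error TH) i t = TH i t,
    x_of_error (theta_error TH) (x_error X Y TH) (y_error X Y TH) i t = X i t &
    y_of_error (theta_error TH) (x_error X Y TH) (y_error X Y TH) i t = Y i t].
Proof.
have e : theta_of_error (theta_error TH) i t = TH i t by rewrite /theta_of_error subrK.
rewrite /x_of_error /y_of_error e /x_error /y_error !subrK /xtilde /ytilde.
have cs := cos2Dsin2 (TH i t); split=> //.
  by rewrite -[RHS]mulr1 -cs; ring.
by rewrite -[RHS]mulr1 -cs; ring.
Qed.

Lemma to_errorK th x y i t : let X := x_of_error th x y in
  let Y := y_of_error th x y in let TH := theta_of_error th in
  [/\ theta_error TH i t = th i t, x_error X Y TH i t = x i t &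
    y_error X Y TH i t = y i t].
Proof.
have cs := cos2Dsin2 (theta_of_error th i t).
split; first by rewrite /theta_error /theta_of_error addrK.
- rewrite /x_error {1}/xtilde /x_of_error /y_of_error.
  apply/eqP; rewrite subr_eq -[X in _ == X]mulr1 -cs; apply/eqP.
  by set C := cos (theta_of_error _ _ _); set S := sin (theta_of_error _ _ _); ring.
- rewrite /y_error {1}/ytilde /x_of_error /y_of_error.
  apply/eqP; rewrite subr_eq -[X in _ == X]mulr1 -cs; apply/eqP.
  by set C := cos (theta_of_error _ _ _); set S := sin (theta_of_error _ _ _); ring.
Qed.

(** [v0] comes back through the derivative [v0 + w0 * yt0] of the leader's coordinate, so it is
    never integrated. *)
Lemma error_to_follower D th x y : D `<=` `[0, +oo[ -> motion D th x y ->
  follower_motion D (x_of_error th x y) (y_of_error th x y) (theta_of_error th).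
Proof.
move=> sub h t Dt i; have [thD xD yD] := h t Dt i.
have [xt0D yt0D] := leader_tilde_motion hleader sub Dt.
have t0 : 0 <= t by have := sub _ Dt; rewrite /= in_itv/= andbT.
have [_ _ /(derivative_in_subset sub) th0D] := hleader t0.
have THD := derivative_inD thD th0D.
have cosD := derivative_in_comp THD (is_derive_cos _).
have sinD := derivative_in_comp THD (is_derive_sin _).
have XD := derivative_inD xD xt0D; have YD := derivative_inD yD yt0D.
have -> : Hact a ((x_error (x_of_error th x y) (y_of_error th x y)
    (theta_of_error th))^~ t) i = Hact a (x^~ t) i.
  by apply: eq_bigr => j _; have [_ -> _] := to_errorK th x y j t.
have -> : Hact a ((theta_error (theta_of_error th))^~ t) i = Hact a (th^~ t) i.
  by apply: eq_bigr => j _; have [-> _ _] := to_errorK th x y j t.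
split.
- apply: derivative_in_eq
    (derivative_inB (derivative_inM XD cosD) (derivative_inM YD sinD)).
  by rewrite /theta_of_error; ring.
- apply: derivative_in_eq
    (derivative_inD (derivative_inM XD sinD) (derivative_inM YD cosD)).
  by rewrite /theta_of_error; ring.
- by apply: derivative_in_eq THD.
Qed.

Hypotheses (hkw : 0 < kw) (hkv : 0 < kv).
Hypothesis hbounded : leader_bounded x0 y0.
Hypothesis hw0 : bounded_exciting w0.
Hypothesis htree : contains_spanning_tree (ord0 : 'I_N.+1) edge.

(** Both clauses are carried over from the error system by the change of coordinates, which is
    invertible at each time. *)
Lemma follower_system_complete :
  forward_complete (follower_system a kw kv v0 w0 x0 y0 theta0).
Proof.
have sub (s : R) : 0 <= s -> `[s, +oo[%classic `<=` `[0, +oo[%classic.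
  by move=> s0 r; rewrite /= !in_itv/= !andbT; exact: le_trans.
split.
- move=> t0 z0 t00.
  pose X := part1 (cst z0); pose Y := part2 (cst z0); pose TH := part3 (cst z0).
  have [th [x [y [h0 h]]]] := error_motion_of_state ha hleader hkw hkv hbounded hw0
    htree ((theta_error TH)^~ t0) ((x_error X Y TH)^~ t0) ((y_error X Y TH)^~ t0) t00.
  exists (stack3 (x_of_error th x y) (y_of_error th x y) (theta_of_error th)).
    rewrite -[RHS]/(cst z0 t0); apply: stacked_eq => i.
    rewrite part1_stack3 part2_stack3 part3_stack3.
    have [e1 e2 e3] := of_errorK X Y TH i t0; have [h1 h2 h3] := h0 i.
    rewrite -[part1 _ _ _]e2 -[part2 _ _ _]e3 -[part3 _ _ _]e1.
    by rewrite /x_of_error /y_of_error /theta_of_error h1 h2 h3.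
  apply/follower_system_motion; rewrite part1_stack3 part2_stack3 part3_stack3.
  by apply: error_to_follower => //; exact: sub.
- move=> t0 t1 z t00 t01 /follower_system_motion h.
  have sub1 : `[t0, t1[%classic `<=` `[0, +oo[%classic.
    by move=> r; rewrite /= !in_itv/= andbT => /andP[+ _]; exact: le_trans.
  have [th [x [y [h' e]]]] := error_motion_extend ha hleader hkw hkv hbounded hw0
    htree t00 t01 (follower_to_error sub1 h).
  exists (stack3 (x_of_error th x y) (y_of_error th x y) (theta_of_error th)).
    apply/follower_system_motion; rewrite part1_stack3 part2_stack3 part3_stack3.
    by apply: error_to_follower => //; exact: sub.
  move=> t tt; apply: stacked_eq => i.
  rewrite part1_stack3 part2_stack3 part3_stack3.
  have [e1 e2 e3] := of_errorK (part1 z) (part2 z) (part3 z) i t.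
  have [h1 h2 h3] := e t tt i.
  rewrite -e1 -{}e2 -{}e3.
  by rewrite /x_of_error /y_of_error /theta_of_error h1 h2 h3.
Qed.

Lemma cos_lipschitz (u v : R) : `|cos u - cos v| <= `|u - v|.
Proof.
wlog uv : u v / v <= u => [H|].
  by have [|/ltW] := leP v u => /H//; rewrite distrC [leRHS]distrC.
have [c _ ->] := MVT_segment uv (fun r _ => is_derive_cos r)
  (continuous_subspaceT (@continuous_cos R)).
rewrite normrM ler_piMl// normrN ler_norml sin_geN1 sin_le1//.
Qed.

Lemma sin_lipschitz (u v : R) : `|sin u - sin v| <= `|u - v|.
Proof.
wlog uv : u v / v <= u => [H|].
  by have [|/ltW] := leP v u => /H//; rewrite distrC [leRHS]distrC.
have [c _ ->] := MVT_segment uv (fun r _ => is_derive_sin r)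
  (continuous_subspaceT (@continuous_sin R)).
rewrite normrM ler_piMl// ler_norml cos_geN1 cos_le1//.
Qed.

(** Follower and leader positions are rotations, by [th + theta0] and [theta0], of their transformed
    coordinates. Their difference consists of the rotated errors and of bounded leader coordinates
    times differences of sines or cosines, which are at most [|th|]. *)
Lemma follower_system_tracking :
  solves_tracking a kw kv v0 w0 x0 y0 theta0.
Proof.
split; first exact: follower_system_complete.
move=> t0 z t00 /follower_system_motion h i.
have sub : `[t0, +oo[%classic `<=` `[0, +oo[%classic.
  by move=> r; rewrite /= !in_itv/= !andbT; exact: le_trans.
have hm := follower_to_error sub h.
have [C [c [l [C0 c0 l0 hP]]]] := error_motion_bound ha theta0 hkw hkv hbounded hw0 htree.
have [m m0 mP] := leader_tilde_bound theta0 hbounded.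
have {hP} := hP t0 _ _ _ t00 hm.
set th := theta_error _ in hm *; set x := x_error _ _ _ in hm *.
set y := y_error _ _ _ in hm * => hP.
(* The factor coming from [l * t0] is included, so that every error is at most
   [K * expR (- l * t)]. *)
pose K := C * Num.sqrt (sqnorm3 (th^~ t0) (x^~ t0) (y^~ t0)) *
  expR (c * Num.sqrt (sqnorm3 (th^~ t0) (x^~ t0) (y^~ t0)) + l * t0).
have comp t j : t0 <= t -> [/\ `|th j t| <= K * expR (- l * t),
    `|x j t| <= K * expR (- l * t) & `|y j t| <= K * expR (- l * t)].
  move=> t0t; have := hP t t0t.
  rewrite (_ : _ * expR _ = K * expR (- l * t)); last first.
    by rewrite /K -[RHS]mulrA -expRD; congr (_ * expR _); ring.
  move=> le; have S (r : R) : r ^+ 2 <= sqnorm3 (th^~ t) (x^~ t) (y^~ t) ->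
      `|r| <= K * expR (- l * t).
    by move=> /ler_wsqrtr; rewrite sqrtr_sqr => /le_trans; apply.
  have T : th j t ^+ 2 + x j t ^+ 2 + y j t ^+ 2 <= sqnorm3 (th^~ t) (x^~ t) (y^~ t).
    rewrite /sqnorm3 (bigD1 j)//= lerDl; apply: sumr_ge0 => k _.
    by rewrite !addr_ge0 ?sqr_ge0.
  have := sqr_ge0 (th j t); have := sqr_ge0 (x j t); have := sqr_ge0 (y j t).
  by move=> ? ? ?; split; apply: S; apply: le_trans T; lra.
(* In [2 + 2 * m], the 2 counts the two rotated errors and [2 * m] the two trigonometric differences
   weighted by leader coordinates. *)
have lim0 (f : R -> R) : (forall t, t0 <= t ->
    `|f t| <= (2 + 2 * m) * K * expR (- l * t)) -> f t @[t --> +oo] --> 0.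
  move=> fK; apply/cvgr0Pnorm_le => e e0.
  have /cvgr0Pnorm_le/(_ e e0) := @expR_decay_cvg0 R ((2 + 2 * m) * K) l l0.
  move=> near_e; near=> t; apply: (le_trans (fK t _)).
    by near: t; apply: nbhs_pinfty_ge; rewrite num_real.
  by apply: le_trans (ler_norm _) _; near: t.
have K0 t : t0 <= t -> 0 <= K * expR (- l * t).
  by move=> t0t; have [+ _ _] := comp t i t0t; exact: le_trans.
have trig (u s A : R) : `|s| <= 1 -> `|u| <= A -> `|u * s| <= A.
  by move=> s1 uA; rewrite normrM -[A]mulr1; exact: ler_pM.
have cos1 u : `|cos u| <= 1 :> R by rewrite ler_norml cos_geN1 cos_le1.
have sin1 u : `|sin u| <= 1 :> R by rewrite ler_norml sin_geN1 sin_le1.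
have diff t (u1 u2 s1 s2 d1 d2 u3 u4 : R) : t0 <= t -> `|u1| <= K * expR (- l * t) ->
    `|u2| <= K * expR (- l * t) -> `|s1| <= 1 -> `|s2| <= 1 ->
    `|u3| <= m -> `|u4| <= m -> `|d1| <= `|th i t| -> `|d2| <= `|th i t| ->
    `|u1 * s1 + u2 * s2 + (u3 * d1 + u4 * d2)| <= (2 + 2 * m) * K * expR (- l * t).
  move=> t0t u1K u2K s11 s21 u3m u4m d1t d2t; have [thK _ _] := comp t i t0t.
  have -> : (2 + 2 * m) * K * expR (- l * t) =
      (K * expR (- l * t) + K * expR (- l * t)) +
      (m * (K * expR (- l * t)) + m * (K * expR (- l * t))) by ring.
  apply: (le_trans (ler_normD _ _)); apply: lerD;
    apply: (le_trans (ler_normD _ _)); apply: lerD.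
  - by apply: trig.
  - by apply: trig.
  - by rewrite normrM; apply: ler_pM => //; exact: le_trans thK.
  - by rewrite normrM; apply: ler_pM => //; exact: le_trans thK.
have inv t : part1 z i t = x_of_error th x y i t /\ part2 z i t = y_of_error th x y i t.
  by have [_ -> ->] := of_errorK (part1 z) (part2 z) (part3 z) i t.
have THE t : part3 z i t = th i t + theta0 t by rewrite /th /theta_error subrK.
have cs t : x0 t = xt0 t * cos (theta0 t) - yt0 t * sin (theta0 t) /\
    y0 t = xt0 t * sin (theta0 t) + yt0 t * cos (theta0 t).
  have cs := cos2Dsin2 (theta0 t); rewrite /xtilde /ytilde; split.
    by rewrite -[LHS]mulr1 -cs; ring.
  by rewrite -[LHS]mulr1 -cs; ring.
have cd t : `|cos (th i t + theta0 t) - cos (theta0 t)| <= `|th i t|.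
  by apply: (le_trans (cos_lipschitz _ _)); rewrite addrK.
have sd t : `|sin (th i t + theta0 t) - sin (theta0 t)| <= `|th i t|.
  by apply: (le_trans (sin_lipschitz _ _)); rewrite addrK.
split.
- apply: lim0 => t t0t; have [_ xK yK] := comp t i t0t.
  have [xm ym] := mP t (le_trans t00 t0t).
  rewrite -[follower_x _ _ _]/(part1 z i t) (inv t).1 (cs t).1.
  rewrite (_ : _ - _ = x i t * cos (th i t + theta0 t) +
    (- y i t) * sin (th i t + theta0 t) +
    (xt0 t * (cos (th i t + theta0 t) - cos (theta0 t)) +
    (- yt0 t) * (sin (th i t + theta0 t) - sin (theta0 t)))); last first.
    by rewrite /x_of_error /theta_of_error; ring.
  by apply: diff; rewrite ?normrN.
- apply: lim0 => t t0t; have [_ xK yK] := comp t i t0t.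
  have [xm ym] := mP t (le_trans t00 t0t).
  rewrite -[follower_y _ _ _]/(part2 z i t) (inv t).2 (cs t).2.
  rewrite (_ : _ - _ = x i t * sin (th i t + theta0 t) +
    y i t * cos (th i t + theta0 t) +
    (xt0 t * (sin (th i t + theta0 t) - sin (theta0 t)) +
    yt0 t * (cos (th i t + theta0 t) - cos (theta0 t)))); last first.
    by rewrite /y_of_error /theta_of_error; ring.
  by apply: diff.
- apply: lim0 => t t0t; have [thK _ _] := comp t i t0t.
  apply: (le_trans thK); rewrite -mulrA ler_peMl//; first exact: K0.
  by lra.
Unshelve. all: by end_near. Qed.

End Followers.

Theorem theorem1 (R : realType) (N : nat) (hN : (1 <= N)%N)
    (edge : rel 'I_N.+1) (a : 'M[R]_(N, N.+1)) (ha : weights_of edge a)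
    (v0 w0 x0 y0 theta0 : R -> R)
    (hleader : leader_motion v0 w0 x0 y0 theta0)
    (kw kv : R) (hkw : 0 < kw) (hkv : 0 < kv)
    (hbounded : leader_bounded x0 y0)
    (hw0 : bounded_exciting w0)
    (htree : contains_spanning_tree (ord0 : 'I_N.+1) edge) :
  UGAS (error_system a kw kv w0 x0 y0 theta0) /\
  solves_tracking a kw kv v0 w0 x0 y0 theta0.
Proof.
split.
  exact: (error_system_UGAS ha hleader hkw hkv hbounded hw0 htree).
exact: (follower_system_tracking ha hleader hkw hkv hbounded hw0 htree).
Qed.
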